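(* For all $\Delta\geq 9$ and $\epsilon>0$, for all large $n>n(\epsilon)$ and $n\geq c\Delta$, there exists a $\Delta$-regular $n$-vertex graph with geometric thickness at least $$c\sqrt{\Delta}\,n^{1/2-4/\Delta-\epsilon},$$ for some absolute constant $c$.
   Context: Graphs are undirected, finite and simple. A geometric drawing of a graph represents each vertex by a distinct point in the plane $\mathbb{R}^2$ and each edge by the straight line segment between its endpoints, such that the only vertices an edge intersects are its own endpoints. Two edges cross if they intersect at a point other than a common endpoint. A drawing is plane if no two edges cross. The thickness of a drawing $D$ is the minimum number of plane subgraphs of $D$ whose union is $D$. The geometric thickness of a graph $G$ is the minimum thickness of a geometric drawing of $G$. Here $\Delta$ and $n$ are integers, and $n(\epsilon)$ denotes a threshold depending only on $\epsilon$.
   Formalization: The formal theorem adds the condition that Δn is even; without it the claim fails, since for example no 9-regular graph has an odd number of vertices. *)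

(* Defs.v *)
From HB Require Import structures.
From mathcomp Require Import all_boot all_order all_algebra.
From mathcomp Require Import ring.
From mathcomp Require Export boolp reals exp.

Set Implicit Arguments.
Unset Strict Implicit.
Unset Printing Implicit Defensive.

Import Order.TTheory GRing.Theory Num.Theory.

Local Open Scope ring_scope.

Record sgraph := SGraph {
  vertex :> finType;
  adj : rel vertex;
  adj_sym : symmetric adj;
  adj_irrefl : irreflexive adj }.

Definition edges (G : sgraph) : {set {set G}} :=
  [set [set u.1; u.2] | u : G * G & adj u.1 u.2]%SET.

Definition regular (G : sgraph) (d : nat) : Prop :=
  forall x : G, #|[set y | adj x y]%SET| = d.

(** The vertex set is part of the data, so that a subgraph may have isolated
    vertices. *)
Record subgraph (G : sgraph) := Subgraph {
  sub_vertices : {set G};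
  sub_edges : {set {set G}};
  sub_edges_edges : {subset sub_edges <= edges G};
  sub_edges_vertices : forall e, e \in sub_edges -> e \subset sub_vertices }.

Definition segment (R : realType) (a b z : 'rV[R]_2) : Prop :=
  exists t : R, [/\ 0 <= t, t <= 1 & z = (1 - t) *: a + t *: b].

(** A drawing is determined by the positions [p] of the vertices. Neither
    collinear vertices nor three concurrent edges are excluded. *)
Definition geometric_drawing (R : realType) (G : sgraph) (p : G -> 'rV[R]_2) :
    Prop :=
  injective p /\
  forall x y v : G, adj x y -> segment (p x) (p y) (p v) -> v = x \/ v = y.

Definition edge_segment (R : realType) (G : sgraph) (p : G -> 'rV[R]_2)
    (e : {set G}) (z : 'rV[R]_2) : Prop :=
  exists x y : G, e = [set x; y]%SET /\ segment (p x) (p y) z.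

Definition cross (R : realType) (G : sgraph) (p : G -> 'rV[R]_2)
    (e f : {set G}) : Prop :=
  exists z, [/\ edge_segment p e z, edge_segment p f z &
                ~ exists2 v : G, v \in e :&: f & z = p v].

Definition plane (R : realType) (G : sgraph) (p : G -> 'rV[R]_2)
    (H : subgraph G) : Prop :=
  forall e f, e \in sub_edges H -> f \in sub_edges H -> e != f ->
    ~ cross p e f.

Definition plane_decomposition (R : realType) (G : sgraph)
    (p : G -> 'rV[R]_2) (k : nat) : Prop :=
  exists H : 'I_k -> subgraph G,
    [/\ forall i, plane p (H i),
        (\bigcup_(i < k) sub_vertices (H i))%SET = [set: G]%SET &
        (\bigcup_(i < k) sub_edges (H i))%SET = edges G].

Lemma plane_decomposition_exists (R : realType) (G : sgraph)
  (p : G -> 'rV[R]_2) : exists k, `[< plane_decomposition p k >].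
Proof.
pose E := edges G.
have sE (e : {set G}) : {subset E :&: [set e] <= edges G}%SET.
  by move=> f /setIP[].
have sV (e : {set G}) f : f \in (E :&: [set e])%SET -> f \subset [set: G]%SET.
  by move=> _; exact: subsetT.
exists #|{set G}|; apply/asboolP.
exists (fun i => Subgraph (sE (enum_val i)) (@sV (enum_val i))); split.
- move=> i e f /=; rewrite !inE => /andP[_ /eqP->] /andP[_ /eqP->].
  by rewrite eqxx.
- apply/setP => x; rewrite inE; apply/bigcupP.
  by exists (enum_rank (set0 : {set G})); rewrite ?inE.
- apply/setP => e; apply/bigcupP/idP => [[i _ /= /setIP[]] //|eE].
  by exists (enum_rank e) => //=; rewrite enum_rankK !inE eqxx andbT.
Qed.

Definition drawing_thickness (R : realType) (G : sgraph)
    (p : G -> 'rV[R]_2) : nat :=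
  ex_minn (plane_decomposition_exists p).

Definition drawable_with_thickness (R : realType) (G : sgraph) (k : nat) :
    Prop :=
  exists p : G -> 'rV[R]_2, geometric_drawing p /\ drawing_thickness p = k.

(** Placing the vertices on a parabola gives a geometric drawing. *)
Lemma geometric_drawing_exists (R : realType) (G : sgraph) :
  exists p : G -> 'rV[R]_2, geometric_drawing p.
Proof.
pose r (v : G) : R := (enum_rank v)%:R.
have r_inj : injective r.
  by move=> u v /eqP; rewrite eqr_nat => /eqP/ord_inj/enum_rank_inj.
pose p v : 'rV[R]_2 := \row_(j < 2) r v ^+ j.+1.
have p0 v : p v 0 0 = r v by rewrite mxE expr1.
have p1 v : p v 0 1 = r v ^+ 2 by rewrite mxE.
exists p; split=> [u v uv|x y v _ [t [_ _ pv]]].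
  by apply: r_inj; rewrite -!p0 uv.
have e0 : r v = (1 - t) * r x + t * r y by rewrite -!p0 pv !mxE.
have e1 : r v ^+ 2 = (1 - t) * r x ^+ 2 + t * r y ^+ 2.
  by rewrite -!p1 [in LHS]pv !mxE.
have /eqP : (r v - r x) * (r v - r y) = 0.
  have -> : (r v - r x) * (r v - r y) =
            r v ^+ 2 - (r x + r y) * r v + r x * r y by ring.
  by rewrite e1 e0; ring.
rewrite mulf_eq0 !subr_eq0 => /orP[] /eqP /r_inj ->; by [left | right].
Qed.

Lemma drawable_with_thickness_exists (R : realType) (G : sgraph) :
  exists k, `[< drawable_with_thickness R G k >].
Proof.
have [p pG] := geometric_drawing_exists R G.
by exists (drawing_thickness p); apply/asboolP; exists p.
Qed.

Definition geometric_thickness (R : realType) (G : sgraph) : nat :=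
  ex_minn (drawable_with_thickness_exists R G).

(* Main.v *)
(** The theorem follows from counting.  Fix an order type of the n vertices;
    there are at most (C n^2)^(2n) = n^((4+o(1))n) of them.  In a geometric
    graph with A edges, A much larger than n, some edge crosses about A^2/n^2
    others (crossing lemma).  Up to logarithmic factors, the noncrossing edge
    sets are thus covered by containers of about n^2/q edges, each of them
    determined by q edges.  A graph with thickness k therefore lies in a union
    of k containers; with q about (eps D n)/k, this leaves
    n^((4 + eps D) n) (k/D)^(D n) possibilities.  On the other hand, joining D
    groups of g = n/(2D) vertices to D other such groups by arbitrary bijections
    gives (g!)^(D^2), about (n/D)^(D n/2), graphs of degree D.

    Order types are counted without Bezout or Warren.  Each sign cell of the
    orientation polynomials f_i contains a maximum of
    prod_i |f_i| exp(- |x|^2/2 - c.x), where for every coordinate j the relation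
    sum_i (d_j f_i)/f_i = x_j + c_j holds.  After clearing denominators its
    degree is only O(n^2), because each vertex occurs in O(n^2) of the f_i.  If
    these maxima were too numerous, then a dimension count would give a
    polynomial relation between the left-hand sides and a linear form
    separating the maxima, and for generic c this relation leaves too few
    values for the linear form. *)

Require Import Defs.
From mathcomp Require Import all_boot all_order all_algebra all_fingroup.
From mathcomp Require Import ring lra zify.
From mathcomp Require Import reals sequences exp.
From mathcomp Require classical_sets topology normedtype derive realfun.

Set Implicit Arguments.
Unset Strict Implicit.
Unset Printing Implicit Defensive.

Import Order.TTheory GRing.Theory Num.Theory.
Local Open Scope ring_scope.

(** * Crossings and order types *)

Lemma leq_expl m n e : (m <= n)%N -> (m ^ e <= n ^ e)%N.
Proof. by move=> mn; elim: e => // e IHe; rewrite !expnS leq_mul. Qed.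

Section OrderTypes.
Variables (R : realType) (V : finType).
Implicit Types (p : V -> 'rV[R]_2) (a b c d : V).

Definition orient p a b c : R :=
  (p b 0 0 - p a 0 0) * (p c 0 1 - p a 0 1) -
  (p c 0 0 - p a 0 0) * (p b 0 1 - p a 0 1).

Definition general_position p :=
  forall a b c, a != b -> a != c -> b != c -> orient p a b c != 0.

(** One Boolean per triple records the whole sign: in general position the orientation vanishes only
    on triples with a repetition, where the value is [false]. *)
Definition order_type p : {ffun V * V * V -> bool} :=
  [ffun t => 0 < orient p t.1.1 t.1.2 t.2].

End OrderTypes.

(** * Plane geometric graphs are sparse *)

(** Crossing is read off the order type alone, so that the containers below can be chosen per order
    type. Edges are ordered pairs, and edges with a common end never cross in this sense. *)
Definition crosses (V : finType) (sg : {ffun V * V * V -> bool}) (e f : V * V) :=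
  [&& uniq [:: e.1; e.2; f.1; f.2],
      sg (e.1, e.2, f.1) != sg (e.1, e.2, f.2) &
      sg (f.1, f.2, e.1) != sg (f.1, f.2, e.2)].

Section Crossings.
Variables (R : realType) (V : finType) (p : V -> 'rV[R]_2).
Hypothesis gp : general_position p.
Hypothesis px_inj : injective (fun v => p v 0 0).
Local Notation px v := (p v 0 0).
Local Notation py v := (p v 0 1).
Local Notation sg := (order_type p).
Implicit Types (e f : V * V) (A : {set V * V}) (W : {set V}).

Lemma sign_neq (x y : R) : x * y < 0 -> (0 < x) != (0 < y).
Proof.
case: (ltrgt0P x) => x0.
- by rewrite pmulr_rlt0 // => y0; rewrite lt_gtF.
- by rewrite nmulr_rlt0 // => ->.
- by rewrite x0 mul0r ltxx.
Qed.

(** The equation says that [a] and [b] are the values at [x] and [y] of an affine function that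
    vanishes at [z]. *)
Lemma opposite_sign (x y z a b : R) : x < z -> z < y -> a != 0 ->
  (y - z) * a = (x - z) * b -> a * b < 0.
Proof.
move=> xz zy a0 E; rewrite -(@nmulr_rgt0 _ (x - z)) ?subr_lt0 //.
by rewrite mulrCA -E mulrCA pmulr_rgt0 ?subr_gt0 // -expr2 exprn_even_gt0.
Qed.

(** The ordinate at abscissa [x] of the line through [e]. *)
Let height e (x : R) : R :=
  py e.1 + (py e.2 - py e.1) * (x - px e.1) / (px e.2 - px e.1).

Let height1 e : height e (px e.1) = py e.1.
Proof. by rewrite /height subrr mulr0 mul0r addr0. Qed.

Let height2 e : px e.1 < px e.2 -> height e (px e.2) = py e.2.
Proof. by move=> e12; rewrite /height mulfK ?subr_eq0 ?gt_eqF // subrKC. Qed.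

Let height_affine e x y z : px e.1 < px e.2 ->
  (y - x) * height e z = (y - z) * height e x + (z - x) * height e y.
Proof. by move=> e12; rewrite /height; field; rewrite subr_eq0 gt_eqF. Qed.

Let orient_height e v : px e.1 < px e.2 ->
  orient p e.1 e.2 v = (px e.2 - px e.1) * (py v - height e (px v)).
Proof. by move=> e12; rewrite /orient /height; field; rewrite subr_eq0 gt_eqF. Qed.

Let gap e f x := height f x - height e x.

(** By [orient_height] the orientation of a point with respect to an edge has the sign of its
    vertical distance to the line. At an end of the other edge this distance is the gap up to
    sign. *)
Let gap_crosses e f : px e.1 < px e.2 -> px f.1 < px f.2 ->
  uniq [:: e.1; e.2; f.1; f.2] ->
  gap e f (px e.1) * gap e f (px e.2) < 0 ->
  gap e f (px f.1) * gap e f (px f.2) < 0 -> crosses sg e f.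
Proof.
move=> e12 f12 uef ge gf; rewrite /crosses uef !ffunE /=.
rewrite !orient_height // !pmulr_rgt0 ?subr_gt0 //.
have r1 : py f.1 - height e (px f.1) = gap e f (px f.1) by rewrite /gap height1.
have r2 : py f.2 - height e (px f.2) = gap e f (px f.2) by rewrite /gap height2.
have r3 : py e.1 - height f (px e.1) = - gap e f (px e.1) by rewrite /gap opprB height1.
have r4 : py e.2 - height f (px e.2) = - gap e f (px e.2) by rewrite /gap opprB height2.
by rewrite -![height _ _ < _]subr_gt0 r1 r2 r3 r4; apply/andP; split; apply: sign_neq => //; rewrite mulrNN.
Qed.

(** * Noncrossing edges that meet a vertical line *)

Section VerticalLine.
Variables (x0 : R) (A : {set V * V}).
Hypothesis A_line : forall e, e \in A -> px e.1 < x0 < px e.2.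
Hypothesis A_noncrossing : forall e f, e \in A -> f \in A -> ~~ crosses sg e f.

Let A_lt e : e \in A -> px e.1 < px e.2.
Proof. by move=> /A_line/andP[]; exact: lt_trans. Qed.

Let h e := height e x0.

Let gap_affine e f x y z : e \in A -> f \in A ->
  (y - x) * gap e f z = (y - z) * gap e f x + (z - x) * gap e f y.
Proof.
move=> /A_lt e12 /A_lt f12; have := height_affine x y z e12.
have := height_affine x y z f12; rewrite /gap; lra.
Qed.

Let gap_neq0 e f v : e \in A -> f \in A ->
  v \in [:: f.1; f.2] -> v \notin [:: e.1; e.2] -> gap e f (px v) != 0.
Proof.
move=> eA fA vf ve; have := gp (_ : e.1 != e.2) (_ : e.1 != v) (_ : e.2 != v).
rewrite orient_height ?A_lt //.
have -> : py v = height f (px v).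
  by move: vf; rewrite !inE => /orP[] /eqP ->; rewrite ?height1 ?height2 ?A_lt.
rewrite mulf_eq0 negb_or /gap => H; apply: (andP (H _ _ _)).2.
- by apply: contraTneq (A_lt eA) => ->; rewrite ltxx.
- by move: ve; rewrite !inE negb_or eq_sym => /andP[].
- by move: ve; rewrite !inE negb_or andbC eq_sym => /andP[].
Qed.

Let lt_neq_ends e f : e \in A -> f \in A -> e.1 != f.2.
Proof.
move=> /A_line/andP[e1 _] /A_line/andP[_ f2].
by apply: contraTneq (lt_trans e1 f2) => ->; rewrite ltxx.
Qed.

Let gapC e f v : gap e f v = - gap f e v. Proof. by rewrite /gap opprB. Qed.

Let uniq_ends e f : e \in A -> f \in A -> e.1 != f.1 -> e.2 != f.2 ->
  uniq [:: e.1; e.2; f.1; f.2].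
Proof.
move=> eA fA ef1 ef2; have f1e2 := lt_neq_ends fA eA; rewrite eq_sym in f1e2.
by rewrite /= !inE !negb_or ef1 ef2 f1e2 !lt_neq_ends.
Qed.

(** At equal heights the gap vanishes at [x0]. With a common end it would vanish identically,
    against general position; otherwise it changes sign along both edges, which makes them cross. *)
Let h_inj : {in A &, injective h}.
Proof.
move=> e f eA fA hef; apply/eqP; apply: contraT => nef.
have g0 : gap e f x0 = 0 by rewrite /gap -/(h f) -/(h e) hef subrr.
have /andP[e1 e2] := A_line eA; have /andP[f1 f2] := A_line fA.
have gE x y : (y - x0) * gap e f x = (x - x0) * gap e f y.
  by have := gap_affine x0 y x eA fA; rewrite g0; lra.
have [e1f1|e1f1] := eqVneq e.1 f.1.
  have e2f2 : f.2 != e.2 by apply: contra nef; rewrite -pair_eqE /pair_eq /= e1f1 eqxx eq_sym.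
  have fe2 : gap e f (px f.2) != 0.
    by apply: gap_neq0 => //; rewrite !inE ?eqxx ?orbT // negb_or e2f2 eq_sym lt_neq_ends.
  have fe1 : gap e f (px f.1) = 0 by rewrite /gap height1 -e1f1 height1 subrr.
  have := gE (px f.1) (px f.2); rewrite fe1 mulr0 => /esym/eqP.
  by rewrite mulf_eq0 subr_eq0 lt_eqF //= (negPf fe2).
have ne1 : gap e f (px f.1) != 0.
  by apply: gap_neq0 => //; rewrite !inE ?eqxx // negb_or eq_sym e1f1 lt_neq_ends.
have [e2f2|e2f2] := eqVneq e.2 f.2.
  have fe2 : gap e f (px f.2) = 0 by rewrite /gap height2 ?A_lt // -e2f2 height2 ?A_lt // subrr.
  have := gE (px f.2) (px f.1); rewrite fe2 mulr0 => /esym/eqP.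
  by rewrite mulf_eq0 subr_eq0 gt_eqF //= (negPf ne1).
have ne2 : gap e f (px e.1) != 0.
  rewrite gapC oppr_eq0; apply: gap_neq0 => //; rewrite !inE ?eqxx // negb_or e1f1 lt_neq_ends //.
have := A_noncrossing eA fA; rewrite gap_crosses ?A_lt ?uniq_ends //.
- exact: opposite_sign e1 e2 ne2 (gE _ _).
- exact: opposite_sign f1 f2 ne1 (gE _ _).
Qed.

(** If the gap were not positive at the later left end, it would be nonpositive at both left ends
    and positive at both right ends. The edges would then cross, or share a right end, where the gap
    is zero. *)
Let order_left e f : e \in A -> f \in A -> e.1 != f.1 -> h e < h f ->
  0 < gap e f (Num.max (px e.1) (px f.1)).
Proof.
move=> eA fA e1f1 hef; set M := Num.max _ _.
have /andP[e1 e2] := A_line eA; have /andP[f1 f2] := A_line fA.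
have g0 : 0 < gap e f x0 by rewrite subr_gt0.
have Mx : M < x0 by rewrite gt_max e1 f1.
have [Me Mf] : px e.1 <= M /\ px f.1 <= M by rewrite !le_max !lexx orbT.
rewrite ltNge; apply/negP => gM.
have gap_l x : x <= M -> gap e f x <= 0.
  by move=> xM; have := gap_affine M x0 x eA fA; nra.
have gap_r x : x0 < x -> 0 < gap e f x.
  by move=> xM; have := gap_affine M x0 x eA fA; nra.
have [e2f2|e2f2] := eqVneq e.2 f.2.
  by have := gap_r _ e2; rewrite /gap height2 ?A_lt // e2f2 height2 ?A_lt // subrr ltxx.
have ne1 : gap e f (px f.1) < 0.
  rewrite lt_neqAle gap_l // andbT; apply: gap_neq0 => //; rewrite !inE ?eqxx //.
  by rewrite negb_or eq_sym e1f1 lt_neq_ends.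
have ne2 : gap e f (px e.1) < 0.
  rewrite lt_neqAle gap_l // andbT gapC oppr_eq0; apply: gap_neq0 => //; rewrite !inE ?eqxx //.
  by rewrite negb_or e1f1 lt_neq_ends.
have := A_noncrossing eA fA; rewrite gap_crosses ?A_lt ?uniq_ends //.
- by rewrite nmulr_rlt0 // gap_r.
- by rewrite nmulr_rlt0 // gap_r.
Qed.

Let order_right e f : e \in A -> f \in A -> e.2 != f.2 -> h e < h f ->
  0 < gap e f (Num.min (px e.2) (px f.2)).
Proof.
move=> eA fA e2f2 hef; set M := Num.min _ _.
have /andP[e1 e2] := A_line eA; have /andP[f1 f2] := A_line fA.
have g0 : 0 < gap e f x0 by rewrite subr_gt0.
have Mx : x0 < M by rewrite lt_min e2 f2.
have [Me Mf] : M <= px e.2 /\ M <= px f.2 by rewrite !ge_min !lexx orbT.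
rewrite ltNge; apply/negP => gM.
have gap_r x : M <= x -> gap e f x <= 0.
  by move=> xM; have := gap_affine M x0 x eA fA; nra.
have gap_l x : x < x0 -> 0 < gap e f x.
  by move=> xM; have := gap_affine M x0 x eA fA; nra.
have [e1f1|e1f1] := eqVneq e.1 f.1.
  by have := gap_l _ e1; rewrite /gap height1 e1f1 height1 subrr ltxx.
have ne1 : gap e f (px f.2) < 0.
  rewrite lt_neqAle gap_r // andbT; apply: gap_neq0 => //; rewrite !inE ?eqxx ?orbT //.
  by rewrite negb_or [_ == e.1]eq_sym [_ == e.2]eq_sym e2f2 lt_neq_ends.
have ne2 : gap e f (px e.2) < 0.
  rewrite lt_neqAle gap_r // andbT gapC oppr_eq0; apply: gap_neq0 => //; rewrite !inE ?eqxx ?orbT //.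
  by rewrite negb_or e2f2 [_ == f.1]eq_sym lt_neq_ends.
have := A_noncrossing eA fA; rewrite gap_crosses ?A_lt ?uniq_ends //.
- by rewrite pmulr_rlt0 // gap_l.
- by rewrite pmulr_rlt0 // gap_l.
Qed.

Let Top (k : V * V -> V) :=
  [set e in A | [forall f in A, (k f == k e) ==> (h f <= h e)]]%SET.
Let Bot (k : V * V -> V) :=
  [set e in A | [forall f in A, (k f == k e) ==> (h e <= h f)]]%SET.

Let card_Top k W : (forall e, e \in A -> k e \in W) -> (#|Top k| <= #|W|)%N.
Proof.
move=> kW; have <- : #|[set k e | e in Top k]%SET| = #|Top k|.
  apply: card_in_imset => e f; rewrite !inE => /andP[eA /forall_inP eT] /andP[fA /forall_inP fT] kef.
  by apply: h_inj => //; apply/eqP; rewrite eq_le (implyP (eT _ fA)) ?(implyP (fT _ eA)) ?kef.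
by apply/subset_leq_card/subsetP => u /imsetP[e]; rewrite inE => /andP[eA _] ->; exact: kW.
Qed.

Let card_Bot k W : (forall e, e \in A -> k e \in W) -> (#|Bot k| <= #|W|)%N.
Proof.
move=> kW; have <- : #|[set k e | e in Bot k]%SET| = #|Bot k|.
  apply: card_in_imset => e f; rewrite !inE => /andP[eA /forall_inP eT] /andP[fA /forall_inP fT] kef.
  by apply: h_inj => //; apply/eqP; rewrite eq_le (implyP (eT _ fA)) ?(implyP (fT _ eA)) ?kef.
by apply/subset_leq_card/subsetP => u /imsetP[e]; rewrite inE => /andP[eA _] ->; exact: kW.
Qed.

Let not_Top k e : e \in A -> e \notin Top k ->
  exists f, [/\ f \in A, k f = k e & h e < h f].
Proof.
move=> eA; rewrite inE eA /= => /forall_inPn[f fA].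
by rewrite negb_imply -ltNge => /andP[/eqP kfe hef]; exists f.
Qed.

Let not_Bot k e : e \in A -> e \notin Bot k ->
  exists f, [/\ f \in A, k f = k e & h f < h e].
Proof.
move=> eA; rewrite inE eA /= => /forall_inPn[f fA].
by rewrite negb_imply -ltNge => /andP[/eqP kfe hef]; exists f.
Qed.

Let adjacent e f := [/\ e \in A, f \in A, h e < h f &
  forall g, g \in A -> h e < h g -> h f <= h g].

(* A break in the order along the line cannot leave both blocks unfinished:
   the left ends of e and f would have to lie on opposite sides of each other. *)
Let adjacent_break (k : V * V -> V) (M : V -> V -> V) :
  commutative M -> (forall u v, M u v = u \/ M u v = v) ->
  (forall e, e \in A -> height e (px (k e)) = py (k e)) ->
  (forall e f, e \in A -> f \in A -> k e != k f -> h e < h f ->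
    0 < gap e f (px (M (k e) (k f)))) ->
  forall e f, adjacent e f -> [|| k e == k f, e \in Top k | f \in Bot k].
Proof.
move=> MC Mk kh ord e f [eA fA hef between].
have [//|nkef] := eqVneq (k e) (k f).
apply: contraT; rewrite /= negb_or => /andP[eT fB].
have [e' [e'A ke' hee']] := not_Top eA eT.
have [f' [f'A kf' hf'f]] := not_Bot fA fB.
have lt_fe' : h f < h e'.
  rewrite lt_neqAle between // andbT; apply: contra nkef => /eqP /h_inj H.
  by rewrite H // ke'.
have lt_f'e : h f' < h e.
  rewrite ltNge le_eqVlt negb_or; apply/andP; split.
    by apply: contra nkef => /eqP /h_inj ->; rewrite // kf'.
  by apply/negP => /(between _ f'A); rewrite leNgt hf'f.
have := ord _ _ eA fA nkef hef.
have := ord _ _ fA e'A _ lt_fe'; rewrite ke' eq_sym MC => /(_ nkef).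
have := ord _ _ f'A eA _ lt_f'e; rewrite kf' eq_sym MC => /(_ nkef).
rewrite /gap !subr_gt0; case: (Mk (k e) (k f)) => ->.
  rewrite (kh _ eA) -{4}ke' kh // ke' => _ g1 g2.
  by have := lt_trans g1 g2; rewrite ltxx.
rewrite (kh _ fA) -{1}kf' kh // kf' => g1 _ g2.
by have := lt_trans g1 g2; rewrite ltxx.
Qed.

(** Go up along the line. Between consecutive edges at least one end changes, and by
    [adjacent_break] either the lower edge is the last one at its old end or the upper edge is the
    first one at its new end. For each of the two ends, each alternative happens at most once per
    vertex. *)
Lemma vertical_line_bound (W1 W2 : {set V}) :
  (forall e, e \in A -> e.1 \in W1 /\ e.2 \in W2) ->
  (#|A| <= 2 * (#|W1| + #|W2|))%N.
Proof.
move=> AW.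
pose above e := [pred f in A | h e < h f].
(* The edge next above [e] on the line. The topmost edge gets itself as a default value and is
   covered by [Top fst]. *)
pose nxt e := if [pick f in above e] is Some f0 then [arg min_(f < f0 in above e) h f]%O else e.
have nxtP e f0 : e \in A -> f0 \in above e -> adjacent e (nxt e).
  move=> eA f0e; rewrite /nxt; case: pickP => [f1 f1e|]; last by move/(_ f0); rewrite f0e.
  case: arg_minP => // f /andP[/= fA hef] fmin.
  by split=> // g gA heg; apply: fmin; rewrite inE /= gA.
have nxt_inj : {in [set e in A | [exists f, f \in above e]]%SET &, injective nxt}.
  move=> e f; rewrite !inE => /andP[eA /existsP[e0 e0e]] /andP[fA /existsP[f0 f0f]] E.
  have [_ _ he eP] := nxtP _ _ eA e0e; have [_ _ hf fP] := nxtP _ _ fA f0f.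
  apply: h_inj => //; apply/eqP; rewrite eq_le !leNgt; apply/andP; split; apply/negP.
    by move=> /(fP _ eA); rewrite -E leNgt he.
  by move=> /(eP _ fA); rewrite E leNgt hf.
pose Pre k := [set e in A | [exists f, f \in above e] & nxt e \in Bot k]%SET.
have card_Pre k W : (forall e, e \in A -> k e \in W) -> (#|Pre k| <= #|W|)%N.
  move=> kW; apply: leq_trans (card_Bot kW).
  have <- : #|[set nxt e | e in Pre k]%SET| = #|Pre k|.
    apply: card_in_imset => e f; rewrite !inE => /and3P[eA ae _] /and3P[fA af _].
    by apply: nxt_inj; rewrite inE ?eA ?fA.
  by apply/subset_leq_card/subsetP => u /imsetP[e]; rewrite inE => /and3P[_ _ ?] ->.
have A1 e : e \in A -> e.1 \in W1 by move=> /AW[].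
have A2 e : e \in A -> e.2 \in W2 by move=> /AW[].
have : (A \subset Top fst :|: Pre fst :|: (Top snd :|: Pre snd))%SET.
  apply/subsetP => e eA; rewrite !in_setU.
  have [/existsP[f0 f0e]|noabove] := boolP [exists f, f \in above e]; last first.
    suff -> : e \in Top fst by [].
    rewrite inE eA; apply/forall_inP => f fA; apply/implyP => _.
    by rewrite leNgt; apply: contra noabove => hef; apply/existsP; exists f; rewrite inE /= fA.
  have adj := nxtP _ _ eA f0e; have [_ fA hef _] := adj.
  have PreE k : (e \in Pre k) = (nxt e \in Bot k).
    rewrite inE eA /=; suff -> : [exists f, f \in above e] by [].
    by apply/existsP; exists f0.
  rewrite !PreE.
  have brk1 : [|| e.1 == (nxt e).1, e \in Top fst | nxt e \in Bot fst].
    apply: (adjacent_break (k := fst) (M := fun u v => if px u <= px v then v else u)) adj.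
    - by move=> u v; case: (ltgtP (px u) (px v)) => // /px_inj.
    - by move=> u v; case: ifP; [right | left].
    - by move=> *; rewrite height1.
    - move=> e' f' eA' f'A ne hef'; have := order_left eA' f'A ne hef'.
      by rewrite maxEle; case: ifP.
  have brk2 : [|| e.2 == (nxt e).2, e \in Top snd | nxt e \in Bot snd].
    apply: (adjacent_break (k := snd) (M := fun u v => if px u <= px v then u else v)) adj.
    - by move=> u v; case: (ltgtP (px u) (px v)) => // /px_inj.
    - by move=> u v; case: ifP; [left | right].
    - by move=> *; rewrite height2 // A_lt.
    - move=> e' f' eA' f'A ne hef'; have := order_right eA' f'A ne hef'.
      by rewrite minEle; case: ifP.
  case/or3P: brk1 => [/eqP e1|->|->]; rewrite ?orbT //.
  case/or3P: brk2 => [/eqP e2|->|->]; rewrite ?orbT //.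
  have E : nxt e = e by apply/esym/eqP; rewrite -pair_eqE /pair_eq e1 e2 !eqxx.
  by move: hef; rewrite E ltxx.
move/subset_leq_card/leq_trans; apply.
apply: leq_trans (leq_card_setU _ _) _; rewrite mulnDr leq_add //.
  apply: leq_trans (leq_card_setU _ _) _; rewrite mul2n -addnn.
  by apply: leq_add; [exact: card_Top A1 | exact: card_Pre A1].
apply: leq_trans (leq_card_setU _ _) _; rewrite mul2n -addnn.
by apply: leq_add; [exact: card_Top A2 | exact: card_Pre A2].
Qed.

End VerticalLine.
End Crossings.

Definition plane_edges (V : finType) (sg : {ffun V * V * V -> bool})
    (W : {set V}) (A : {set V * V}) :=
  [/\ forall e, e \in A -> e.1 \in W /\ e.2 \in W,
      forall e, e \in A -> e.1 != e.2 &
      forall e f, e \in A -> f \in A -> ~~ crosses sg e f].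

(** * Divide and conquer by abscissa *)

Section PlaneBound.
Variables (R : realType) (V : finType) (p : V -> 'rV[R]_2).
Hypothesis gp : general_position p.
Hypothesis px_inj : injective (fun v => p v 0 0).
Local Notation px v := (p v 0 0).
Local Notation sg := (order_type p).

Lemma split_set (W : {set V}) k : (k <= #|W|)%N ->
  exists W1 : {set V}, [/\ W1 \subset W, #|W1| = k &
    forall u v, u \in W1 -> v \in W :\: W1 -> px u < px v].
Proof.
elim: k => [_|k IHk kW].
  by exists set0; rewrite sub0set cards0; split=> // u v; rewrite inE.
have [W1 [W1W cW1 lt1]] := IHk (ltnW kW).
have [v0 v0W] : exists v, v \in W :\: W1.
  by apply/set0Pn; rewrite -card_gt0 cardsD (setIidPr W1W) cW1 subn_gt0.
have [v vW vmin] := arg_minP (P := fun v => v \in W :\: W1) (fun v => px v) v0W.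
have : v \in W :\: W1 by [].
rewrite inE => /andP[vW1 vW'].
exists (v |: W1); split.
- by rewrite subUset sub1set vW'.
- by rewrite cardsU1 vW1 cW1.
move=> u w; rewrite !inE negb_or => /orP[/eqP ->|uW1] /andP[/andP[wv wW1] wW].
  have le_vw : px v <= px w by apply: vmin; rewrite /= inE wW1.
  rewrite lt_neqAle le_vw andbT.
  by apply: contra wv => /eqP/px_inj ->.
by apply: lt1 => //; rewrite inE wW1.
Qed.

(** Split off the [2 ^ l] leftmost vertices of [W]. Edges inside the two parts are counted by
    induction, and those between the parts meet a common vertical line, so [vertical_line_bound]
    leaves at most [2 * #|W|] of them at each of the [l] levels. *)
Lemma plane_bound_lr l (W : {set V}) (A : {set V * V}) :
  plane_edges sg W A -> (forall e, e \in A -> px e.1 < px e.2) ->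
  (#|W| <= 2 ^ l)%N -> (#|A| <= 2 * l * #|W|)%N.
Proof.
elim: l W A => [|l IHl] W A [AW _ nc] lr cW.
  rewrite muln0 mul0n leqn0 cards_eq0; apply/eqP/setP => e; rewrite inE.
  apply/negP => eA; have [e1 e2] := AW _ eA.
  have e12 : e.1 = e.2 by apply: (card_le1_eqP cW).
  by have := lr _ eA; rewrite e12 ltxx.
have [ltW|leW] := ltnP (2 ^ l) #|W|; last first.
  apply: leq_trans (IHl W A _ lr leW) _; last by rewrite leq_mul2r leq_mul2l leqnSn ?orbT.
  by split=> // e /lr; apply: contraTneq => ->; rewrite ltxx.
have [W1 [W1W cW1 lt12]] := split_set (ltnW ltW).
set W2 := W :\: W1 in lt12.
have cW12 : #|W| = (#|W1| + #|W2|)%N by rewrite cardsD (setIidPr W1W) subnKC ?subset_leq_card.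
have [u0 u0W] : exists u, u \in W1 by apply/set0Pn; rewrite -card_gt0 cW1 expn_gt0.
have [v0 v0W] : exists v, v \in W2.
  by apply/set0Pn; rewrite -card_gt0; move: ltW; rewrite cW12 cW1; lia.
have [u uW umax] := arg_maxP (P := fun v => v \in W1) (fun v => px v) u0W.
have [v vW vmin] := arg_minP (P := fun v => v \in W2) (fun v => px v) v0W.
have uv : px u < px v by apply: lt12.
pose E (X Y : {set V}) : {set V * V} := [set e in A | (e.1 \in X) && (e.2 \in Y)].
have EA X Y e : e \in E X Y -> [/\ e \in A, e.1 \in X & e.2 \in Y].
  by rewrite inE => /andP[eA /andP[]].
have side w : w \in W -> (w \in W1) || (w \in W2) by rewrite /W2 !inE => ->; rewrite andbT orbN.
have : A \subset E W1 W1 :|: E W2 W2 :|: E W1 W2.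
  apply/subsetP => e eA; have [e1 e2] := AW _ eA.
  have inE3 X Y : (e \in E X Y) = (e.1 \in X) && (e.2 \in Y) by rewrite inE eA.
  rewrite !in_setU !inE3; case/orP: (side _ e1) => e1W; case/orP: (side _ e2) => e2W; rewrite e1W e2W ?orbT //.
  by have := lt_trans (lt12 _ _ e2W e1W) (lr _ eA); rewrite ltxx.
move/subset_leq_card/leq_trans; apply.
apply: leq_trans (leq_card_setU _ _) _.
have plane_E X : plane_edges sg X (E X X).
  split=> [e /EA[] //|e /EA[/lr + _ _]|e f /EA[eA _ _] /EA[fA _ _]]; last exact: nc.
  by apply: contraTneq => ->; rewrite ltxx.
have b1 : (#|E W1 W1| <= 2 * l * #|W1|)%N.
  by apply: IHl => // [e /EA[/lr]|] //; rewrite cW1.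
have b2 : (#|E W2 W2| <= 2 * l * #|W2|)%N.
  by apply: IHl => // [e /EA[/lr]|] //; move: cW; rewrite cW12 cW1 expnS mul2n -addnn leq_add2l.
have b3 : (#|E W1 W2| <= 2 * (#|W1| + #|W2|))%N.
  apply: (@vertical_line_bound _ _ _ gp px_inj ((px u + px v) / 2)).
  - move=> e /EA[_ e1 e2]; have : px e.1 <= px u by exact: umax.
    have := vmin _ e2; move: uv.
    by move: (px u) (px v) (px e.1) (px e.2) => *; apply/andP; split; lra.
  - by move=> e f /EA[eA _ _] /EA[fA _ _]; exact: nc.
  - by move=> e /EA[].
apply: leq_trans (leq_add (leq_card_setU _ _) (leqnn _)) _.
rewrite cW12; nia.
Qed.

(** Reversing an edge negates its orientations. In general position this flips each Boolean, so
    whether two of them differ is unaffected. *)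
Lemma crosses_swap e f : crosses sg (e.2, e.1) (f.2, f.1) -> crosses sg e f.
Proof.
rewrite /crosses !ffunE /= !inE !negb_or.
case/and3P => /and3P[/and3P[u1 u2 u3] /andP[u4 u5] u6].
have swap a b c d : a != b -> a != c -> b != c -> a != d -> b != d ->
    (0 < orient p b a c) != (0 < orient p b a d) ->
    (0 < orient p a b d) != (0 < orient p a b c).
  move=> ab ac bc ad bd; have := gp ab ac bc; have := gp ab ad bd.
  have opp v : orient p b a v = - orient p a b v by rewrite /orient; ring.
  rewrite !opp !oppr_gt0; move: (orient p a b d) (orient p a b c) => x y.
  by case: (ltrgt0P x) => //; case: (ltrgt0P y).
move=> /swap s1 /swap s2; apply/and3P; split.
- by rewrite (eq_sym e.1 e.2) (eq_sym f.1 f.2) u1 u2 u3 u4 u5 u6.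
- by apply: s1 => //; rewrite eq_sym.
- by apply: s2 => //; rewrite eq_sym //; case/andP: u6.
Qed.

(** Edges that run from right to left are reversed and counted separately, whence twice the bound of
    [plane_bound_lr]. *)
Lemma plane_bound l (W : {set V}) (A : {set V * V}) :
  plane_edges sg W A -> (#|W| <= 2 ^ l)%N -> (#|A| <= 4 * l * #|W|)%N.
Proof.
move=> [AW Airr nc] cW.
pose A1 : {set V * V} := [set e in A | px e.1 < px e.2].
pose A2 : {set V * V} := [set e in A | px e.2 < px e.1].
have : A \subset A1 :|: A2.
  apply/subsetP => e eA; rewrite !inE eA /=.
  by rewrite -neq_lt; apply: contra (Airr _ eA) => /eqP /px_inj ->.
move/subset_leq_card/leq_trans; apply; apply: leq_trans (leq_card_setU _ _) _.
pose sw (e : V * V) := (e.2, e.1).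
have sw_inj : injective sw by move=> [a b] [c d] [-> ->].
have -> : (4 * l * #|W| = 2 * l * #|W| + 2 * l * #|W|)%N by lia.
apply: leq_add.
  apply: plane_bound_lr => // [|e]; last by rewrite inE => /andP[].
  split=> [e|e|e f]; rewrite !inE => /andP[eA _]; [exact: AW|exact: Airr|].
  by move=> /andP[fA _]; exact: nc.
rewrite -(card_imset _ sw_inj); apply: plane_bound_lr => //; last first.
  by move=> e /imsetP[f]; rewrite inE => /andP[_ lef] ->.
split=> [e|e|e f] /imsetP[e']; rewrite inE => /andP[eA _] ->.
- by have [] := AW _ eA.
- by rewrite eq_sym; exact: Airr.
move=> /imsetP[f']; rewrite inE => /andP[fA _] ->.
by apply: contra (nc _ _ eA fA); exact: crosses_swap.
Qed.

End PlaneBound.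

(** * Crossings in dense geometric graphs *)

(** The probability that a uniform colouring vanishes on [S], with denominators cleared. *)
Lemma card_ffun_vanishing (V : finType) (Q : nat) (S : {set V}) :
  (#|[set chi : {ffun V -> 'I_Q.+1} | [forall v in S, chi v == ord0]]| * Q.+1 ^ #|S| =
   Q.+1 ^ #|V|)%N.
Proof.
pose F v : {pred 'I_Q.+1} := if v \in S then pred1 ord0 else predT.
have -> : #|[set chi : {ffun V -> 'I_Q.+1} | [forall v in S, chi v == ord0]]| = #|family F|.
  apply: eq_card => chi; rewrite inE; apply/forall_inP/familyP => H v.
    by rewrite /F; case: ifP => // /H.
  by move=> vS; have := H v; rewrite /F vS inE.
rewrite card_family foldrE big_image /= (bigID (mem S)) /= big1 ?mul1n; last first.
  by move=> v vS; rewrite /F vS card1.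
rewrite (eq_bigr (fun=> Q.+1)) => [|v /negPf vS]; last by rewrite /F vS card_ord.
rewrite prod_nat_const -expnD; congr (_ ^ _)%N.
by rewrite addnC -[RHS](cardC S); congr (_ + _)%N; apply: eq_card => v; rewrite !inE.
Qed.

Section Supersaturation.
Variables (R : realType) (V : finType) (p : V -> 'rV[R]_2).
Hypothesis gp : general_position p.
Hypothesis px_inj : injective (fun v => p v 0 0).
Local Notation sg := (order_type p).
Variable l : nat.
Hypothesis cardV : (#|V| <= 2 ^ l)%N.

Definition crossing_pairs (A : {set V * V}) :=
  [set u : (V * V) * (V * V) | [&& u.1 \in A, u.2 \in A & crosses sg u.1 u.2]].

(** Deleting one edge of a crossing destroys at least one crossing pair, and [plane_bound] applies
    once none is left. *)
Lemma crossing_pairs_lb (W : {set V}) (A : {set V * V}) :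
  (forall e, e \in A -> e.1 \in W /\ e.2 \in W) -> (forall e, e \in A -> e.1 != e.2) ->
  (#|A| <= 4 * l * #|W| + #|crossing_pairs A|)%N.
Proof.
have [m] := ubnP #|A|; elim: m A => // m IHm A ltA AW Airr.
have [A0|/set0Pn[[e f]]] := eqVneq (crossing_pairs A) set0.
  rewrite A0 cards0 addn0; apply: (plane_bound gp px_inj); last first.
    exact: leq_trans (max_card _) cardV.
  split=> // e f eA fA; apply/negP => ef.
  by have : (e, f) \in crossing_pairs A; [rewrite inE eA fA | rewrite A0 inE].
rewrite inE /= => /and3P[eA fA ef].
have AE : #|A| = #|A :\ e|.+1 by rewrite (cardsD1 e A) eA.
have := IHm (A :\ e); rewrite -AE => /(_ ltA) IH.
have H : (#|A :\ e| <= 4 * l * #|W| + #|crossing_pairs (A :\ e)|)%N.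
  by apply: IH => g; rewrite inE => /andP[_ gA]; [exact: AW | exact: Airr].
suff : (#|crossing_pairs (A :\ e)| < #|crossing_pairs A|)%N by move=> ltc; rewrite AE; apply: (leq_ltn_trans H); rewrite ltn_add2l.
apply/proper_card/properP; split.
  by apply/subsetP => u; rewrite !inE => /and3P[/andP[_ ->] /andP[_ ->] ->].
by exists (e, f); rewrite !inE /= ?eA ?fA ?eqxx.
Qed.

(* Averages the previous bound over the random set of density 1/(Q+1) where a
   uniform colouring [chi] vanishes. *)
Lemma sampled_crossing_bound (Q : nat) (A : {set V * V}) :
  (forall e, e \in A -> e.1 != e.2) ->
  (#|A| * Q.+1 ^ 2 <= 4 * l * #|V| * Q.+1 ^ 3 + #|crossing_pairs A|)%N.
Proof.
move=> Airr; pose X : finType := {ffun V -> 'I_Q.+1}.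
pose Z (chi : X) : {set V} := [set v | chi v == ord0].
pose AZ (chi : X) : {set V * V} := [set e in A | (e.1 \in Z chi) && (e.2 \in Z chi)].
have count (T : finType) (P : pred T) (S : T -> {set V}) (s : nat) : (forall t, P t -> #|S t| = s) ->
    ((\sum_(chi : X) #|[set t | P t && (S t \subset Z chi)]|) * Q.+1 ^ s = #|[set t | P t]| * Q.+1 ^ #|V|)%N.
  move=> PS; under eq_bigr do rewrite -sum1dep_card big_mkcondr.
  rewrite exchange_big /= big_distrl -[in RHS]sum1dep_card big_distrl.
  apply: eq_bigr => t Pt; rewrite /= mul1n -(card_ffun_vanishing Q (S t)) (PS t Pt).
  congr (_ * _)%N; rewrite -big_mkcond sum1dep_card; apply: eq_card => chi.
  rewrite !inE; apply/subsetP/forall_inP => H v /H; by rewrite inE.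
have cV : ((\sum_chi #|Z chi|) * Q.+1 = #|V| * Q.+1 ^ #|V|)%N.
  have := count V predT (fun v => [set v]) 1%N (fun v _ => cards1 v).
  have -> : #|[set v : V | predT v]| = #|V| by apply: eq_card => v; rewrite inE.
  rewrite expn1 => <-; congr (_ * _)%N; apply: eq_bigr => chi _.
  by apply: eq_card => v; rewrite !inE sub1set inE.
have cA : ((\sum_chi #|AZ chi|) * Q.+1 ^ 2 = #|A| * Q.+1 ^ #|V|)%N.
  have := count _ (mem A) (fun e => [set e.1; e.2]) 2%N.
  have -> : #|[set e | mem A e]| = #|A| by apply: eq_card => e; rewrite inE.
  move=> <- => [|e /Airr e12]; last by rewrite cards2 e12.
  congr (_ * _)%N; apply: eq_bigr => chi _.
  by apply: eq_card => e; rewrite !inE subUset !sub1set !inE.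
(* [crosses] demands four distinct ends, so a crossing pair survives the sampling with probability
   one over [Q.+1 ^ 4]. *)
have cC : ((\sum_chi #|crossing_pairs (AZ chi)|) * Q.+1 ^ 4 =
    #|crossing_pairs A| * Q.+1 ^ #|V|)%N.
  have := count _ (mem (crossing_pairs A)) (fun u => [set:: [:: u.1.1; u.1.2; u.2.1; u.2.2]]) 4%N.
  have -> : #|[set u | mem (crossing_pairs A) u]| = #|crossing_pairs A|.
    by apply: eq_card => u; rewrite inE.
  move=> <- => [|u]; last first.
    by rewrite /= inE => /and3P[_ _ /and3P[uu _ _]]; rewrite cardsE; apply/card_uniqP.
  congr (_ * _)%N; apply: eq_bigr => chi _.
  apply: eq_card => u; rewrite !inE.
  have -> : ([set:: [:: u.1.1; u.1.2; u.2.1; u.2.2]] \subset Z chi) =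
      [&& u.1.1 \in Z chi, u.1.2 \in Z chi, u.2.1 \in Z chi & u.2.2 \in Z chi].
    apply/subsetP/and4P => [H|[? ? ? ?] v].
      by split; apply: H; rewrite !inE eqxx ?orbT.
    by rewrite in_set !in_cons in_nil orbF => /or4P[] /eqP ->.
  rewrite !inE; move: (u.1 \in A) (u.2 \in A) (crosses sg u.1 u.2).
  move: (chi u.1.1 == ord0) (chi u.1.2 == ord0) (chi u.2.1 == ord0) (chi u.2.2 == ord0).
  by do 7 case.
have sum_le : (\sum_chi #|AZ chi| <=
    4 * l * (\sum_chi #|Z chi|) + \sum_chi #|crossing_pairs (AZ chi)|)%N.
  rewrite big_distrr -big_split; apply: leq_sum => chi _ /=.
  apply: crossing_pairs_lb => e; rewrite inE => /andP[eA /andP[]] //.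
  by move=> _ _; exact: Airr.
have Q0 : (0 < Q.+1 ^ #|V|)%N by rewrite expn_gt0.
move: cV cA cC sum_le Q0; move: (\sum_chi #|Z chi|)%N (\sum_chi #|AZ chi|)%N (\sum_chi #|crossing_pairs _|)%N => sV sA sC.
move: (Q.+1) #|crossing_pairs A| #|A| #|V| (Q.+1 ^ #|V|)%N => q c a n T cV cA cC sum_le T0.
rewrite -(leq_pmul2r T0) mulnDl -cC (mulnAC a) -cA.
have -> : (4 * l * n * q ^ 3 * T = 4 * l * sV * q ^ 4)%N.
  have -> : (4 * l * n * q ^ 3 * T = 4 * l * (n * T) * q ^ 3)%N by lia.
  by rewrite -cV !expnS; lia.
have -> : (sA * q ^ 2 * q ^ 2 = sA * q ^ 4)%N by rewrite -mulnA -expnD.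
by rewrite -mulnDl leq_mul2r sum_le orbT.
Qed.

(** Otherwise there are fewer than [#|A| * Q.+1 ^ 2 / 2] crossing pairs. The lower bound on [#|A|]
    makes the other term of [sampled_crossing_bound] at most as large, a contradiction. *)
Lemma supersaturation (Q : nat) (A : {set V * V}) :
  (forall e, e \in A -> e.1 != e.2) -> (0 < #|A|)%N ->
  (8 * l * #|V| * Q.+1 <= #|A|)%N ->
  exists2 e, e \in A & (Q.+1 ^ 2 <= 2 * #|[set f in A | crosses sg e f]|)%N.
Proof.
move=> Airr A0 QA; apply/exists_inP; rewrite -[X in is_true X]negbK negb_exists_in.
apply/negP => /forall_inP few.
have := sampled_crossing_bound Q Airr.
have : (#|crossing_pairs A| = \sum_(e in A) #|[set f in A | crosses sg e f]|)%N.
  rewrite -sum1dep_card; under [RHS]eq_bigr do rewrite -sum1dep_card.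
  by rewrite pair_big_dep /=; apply: eq_bigl => -[e f].
have : (2 * \sum_(e in A) #|[set f in A | crosses sg e f]| < \sum_(e in A) Q.+1 ^ 2)%N.
  rewrite big_distrr /=; apply: (@leq_trans (\sum_(e in A) (2 * #|[set f in A | crosses sg e f]|).+1)).
    rewrite [X in (_ <= X)%N](eq_bigr (fun e => 2 * #|[set f in A | crosses sg e f]| + 1)%N).
      by rewrite [X in (_ <= X)%N]big_split /= sum_nat_const muln1 -addn1 leq_add2l.
    by move=> e _; rewrite addn1.
  by apply: leq_sum => e /few; rewrite -ltnNge.
rewrite sum_nat_const; move=> h1 h2; rewrite h2.
have : (4 * l * #|V| * Q.+1 ^ 3 * 2 <= #|A| * Q.+1 ^ 2)%N.
  by rewrite (expnSr _ 2) mulnA mulnAC; nia.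
lia.
Qed.

End Supersaturation.

(** * Containers for noncrossing edge sets *)

(* An independent set avoids either the vertex [a] of large degree or all
   neighbours of [a], and the second alternative shrinks [A] by the factor [rho]. *)
Lemma independent_set_containers (R : realDomainType) (X : finType) (r : rel X)
    (D : {set X}) (rho : R) (M : nat) :
  0 <= rho ->
  (forall A : {set X}, A \subset D -> (M < #|A|)%N -> exists2 a, a \in A &
     #|[set b in A | ~~ r a b]|%:R <= rho * #|A|%:R) ->
  forall q (A : {set X}), A \subset D -> #|A|%:R * rho ^+ q <= M%:R ->
  exists F : {set {set X}}, [/\ (#|F| <= #|A|.+1 ^ q)%N,
    forall C, C \in F -> (#|C| <= M + q)%N &
    forall I : {set X}, I \subset A -> (forall a b, a \in I -> b \in I -> ~~ r a b) ->
      exists2 C, C \in F & I \subset C].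
Proof.
move=> rho0 dense q A; have [m] := ubnP #|A|.
elim: m A q => // m IHm A q ltA AD Aq.
have [AM|MA] := leqP #|A| M.
  exists [set A]; split=> [|C|I IA _].
  - by rewrite cards1 expn_gt0.
  - by rewrite inE => /eqP ->; rewrite (leq_trans AM) ?leq_addr.
  - by exists A; rewrite ?inE.
(* With no choices left, the hypothesis on [#|A|%:R * rho ^+ q] already gives [#|A| <= M]. *)
case: q Aq => [|q] Aq; first by move: Aq; rewrite expr0 mulr1 ler_nat leqNgt MA.
have [a aA few] := dense A AD MA.
pose A2 := [set b in A | ~~ r a b] :\ a.
have cA : #|A| = #|A :\ a|.+1 by rewrite (cardsD1 a A) aA.
have A2A : A2 \subset A :\ a.
  by apply/subsetP => b; rewrite !inE => /and3P[-> ->].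
have cA2 := subset_leq_card A2A.
have [||F1 [cF1 F1M F1I]] := IHm (A :\ a) q.+1 _ (subset_trans (subsetDl _ _) AD).
- by rewrite -ltnS -cA.
- apply: le_trans Aq; rewrite ler_wpM2r ?exprn_ge0 // ler_nat.
  by rewrite cA leqnSn.
(* A set containing [a] misses the neighbours of [a]. This choice uses up one unit of [q], is paid
   for by the factor [rho], and puts [a] back into the containers, whence the [+ q] in their
   size. *)
have [||F2 [cF2 F2M F2I]] := IHm A2 q _ (subset_trans A2A (subset_trans (subsetDl _ _) AD)).
- by apply: leq_ltn_trans cA2 _; rewrite -ltnS -cA.
- apply: le_trans Aq; rewrite exprS mulrA [#|A|%:R * _]mulrC.
  rewrite ler_wpM2r ?exprn_ge0 //; apply: le_trans few.
  by rewrite ler_nat subset_leq_card // subsetDl.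
exists (F1 :|: [set a |: C | C in F2]); split.
- apply: leq_trans (leq_card_setU _ _) _.
  apply: (@leq_trans (#|A| ^ q.+1 + #|A| ^ q)).
    apply: leq_add; first by rewrite cA.
    apply: leq_trans (leq_imset_card _ _) _; apply: leq_trans cF2 _.
    by apply: leq_expl; rewrite cA ltnS.
  by rewrite expnSr -{2}[(_ ^ q)%N]muln1 -mulnDr addn1 expnSr leq_mul2r leq_expl ?orbT.
- move=> C; rewrite inE => /orP[/F1M //|/imsetP[C' /F2M C'M ->]].
  by rewrite cardsU1 addnS -add1n leq_add ?leq_b1.
move=> I IA Iindep; have [aI|aI] := boolP (a \in I).
  have [||C CF IC] := F2I (I :\ a).
  - apply/subsetP => b; rewrite !inE => /andP[-> bI].
    by rewrite (subsetP IA) //= Iindep.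
  - by move=> b c; rewrite !inE => /andP[_ bI] /andP[_ cI]; exact: Iindep.
  exists (a |: C); first by rewrite inE imset_f ?orbT.
  by rewrite -(setD1K aI) setUS.
have [|C CF IC] := F1I I _ Iindep.
- by rewrite subsetD1 IA.
by exists C; rewrite // inE CF.
Qed.

Lemma expR_natl_ge (R : realType) (l : nat) : (2 ^ l)%:R <= expR (l%:R : R).
Proof.
rewrite -[l%:R]mulr1 expRM_natl natrX lerXn2r ?nnegrE ?expR_ge0 //.
by have := expR_ge1Dx (1 : R); lra.
Qed.

(** As long as [A] has more than [8 * l * #|V| * Q] edges, [supersaturation] yields an edge that
    crosses at least the fraction [x = Q / (32 * l * #|V|)] of [A]. The condition on [q * Q] says
    that [x * q >= 2 * l], so [q] reductions by [expR (- x)] outweigh the at most [#|V| ^ 2]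
    edges. *)
Lemma plane_containers (R : realType) (V : finType) (p : V -> 'rV[R]_2) (l Q q : nat) :
  general_position p -> injective (fun v => p v 0 0) ->
  (0 < l)%N -> (#|V| <= 2 ^ l)%N -> (0 < Q)%N -> (64 * l ^ 2 * #|V| <= q * Q)%N ->
  exists F : {set {set V * V}}, [/\ (#|F| <= (#|V| ^ 2).+1 ^ q)%N,
    forall C, C \in F -> (#|C| <= 8 * l * #|V| * Q + q)%N &
    forall I : {set V * V}, (forall e, e \in I -> e.1 != e.2) ->
      (forall e f, e \in I -> f \in I -> ~~ crosses (order_type p) e f) ->
      exists2 C, C \in F & I \subset C].
Proof.
move=> gp px_inj l0 cV Q0 qQ; set n := #|V|; set M := (8 * l * n * Q)%N.
pose D : {set V * V} := [set e | e.1 != e.2].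
have cD : (#|D| <= n ^ 2)%N by rewrite (leq_trans (max_card _)) // card_prod mulnn.
pose x : R := Q%:R / (32 * l * n)%:R.
have dense (A : {set V * V}) : A \subset D -> (M < #|A|)%N -> exists2 a, a \in A &
   #|[set b in A | ~~ crosses (order_type p) a b]|%:R <= expR (- x) * #|A|%:R :> R.
  move=> AD MA; have A0 : (0 < #|A|)%N by apply: leq_ltn_trans MA.
  have n0 : (0 < n)%N.
    by have := leq_trans A0 (leq_trans (subset_leq_card AD) cD); case: (n).
  have k0 : (0 < 8 * l * n)%N by rewrite !muln_gt0 l0 n0.
  pose Q1 := (#|A| %/ (8 * l * n))%N.
  have QQ1 : (Q <= Q1)%N by rewrite leq_divRL // mulnC ltnW.
  have Q1E : Q1.-1.+1 = Q1 by rewrite prednK // (leq_trans Q0).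
  have [|//||e eA] := supersaturation gp px_inj cV (Q := Q1.-1) (A := A).
  - by move=> e /(subsetP AD); rewrite inE.
  - by rewrite Q1E mulnC leq_trunc_div.
  rewrite Q1E => deg; exists e => //.
  have cA : #|A| = (#|[set f in A | crosses (order_type p) e f]| +
      #|[set b in A | ~~ crosses (order_type p) e b]|)%N.
    rewrite -(cardsID [set f | crosses (order_type p) e f] A); congr (_ + _)%N; apply: eq_card => f.
      by rewrite !inE.
    by rewrite !inE andbC.
  apply: (@le_trans _ _ ((1 - x) * #|A|%:R)); last first.
    by rewrite ler_wpM2r // -[1 - x]/(1 + - x) expR_ge1Dx.
  have key : (#|A| * Q <= 32 * l * n * #|[set f in A | crosses (order_type p) e f]|)%N.
    have AQ1 : (#|A| <= 16 * l * n * Q1)%N.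
      have := ltn_ceil #|A| k0; rewrite -/Q1; have : (0 < Q1)%N by rewrite -Q1E.
      nia.
    apply: (@leq_trans (16 * l * n * Q1 * Q1)); first exact: leq_mul.
    by rewrite -mulnA mulnn; nia.
  have d0 : 0 < (32 * l * n)%:R :> R by rewrite ltr0n !muln_gt0 l0 n0.
  rewrite mulrBl mul1r lerBrDr [x * _]mulrC.
  rewrite {2}cA natrD addrC lerD2r /x mulrA ler_pdivrMr //.
  by rewrite -!natrM ler_nat (mulnC #|[set f in A | _]|).
have rho0 : 0 <= expR (- x) by exact: expR_ge0.
have Dq : #|D|%:R * expR (- x) ^+ q <= M%:R :> R.
  have [n0|n0] := posnP n.
    by move: cD; rewrite n0 leqn0 => /eqP ->; rewrite mul0r ler0n.
  apply: (@le_trans _ _ 1); last by rewrite ler1n !muln_gt0 l0 n0.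
  rewrite -expRM_natl mulrN expRN ler_pdivrMr ?expR_gt0 // mul1r.
  apply: (@le_trans _ _ (expR (l + l)%:R)).
    apply: le_trans (expR_natl_ge _ _); rewrite ler_nat (leq_trans cD) //.
    by rewrite expnD -mulnn leq_mul.
  rewrite ler_expR /x mulrA ler_pdivlMr ?ltr0n ?muln_gt0 ?l0 ?n0 //.
  by rewrite -!natrM ler_nat; apply: leq_trans qQ; rewrite -mulnn; nia.
have [F [cF FM FI]] := independent_set_containers rho0 dense (subxx D) Dq.
exists F; split=> //.
  by apply: leq_trans cF _; apply: leq_expl; rewrite ltnS.
move=> I Iirr Inc; apply: FI => //; apply/subsetP => e /Iirr; by rewrite inE.
Qed.

(** * Counting order types *)

Section PolynomialFunctions.
Variables (R : realType) (N : nat).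
Implicit Types (f g : 'rV[R]_N -> R) (d e : nat).

Definition monomial (a : 'I_N -> nat) (x : 'rV[R]_N) : R :=
  \prod_(j < N) x 0 j ^+ a j.

(** Polynomials are needed only as functions. Indexing the coefficients by bounded tuples makes the
    monomials a finite set whose cardinal is a binomial coefficient. *)
Definition polyfun d f :=
  exists c : N.-tuple 'I_d.+1 -> R, forall x,
    f x = \sum_(t in [set t : N.-tuple 'I_d.+1 | (\sum_(i <- t) i <= d)%N])
            c t * monomial (fun j => tnth t j) x.

Lemma polyfun_ext d f g : f =1 g -> polyfun d f -> polyfun d g.
Proof. by move=> fg [c fE]; exists c => x; rewrite -fg fE. Qed.

Lemma polyfun_monomial d (a : 'I_N -> nat) :
  (\sum_j a j <= d)%N -> polyfun d (monomial a).
Proof.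
move=> ad; pose t0 : N.-tuple 'I_d.+1 := [tuple inord (a j) | j < N].
have t0E j : tnth t0 j = a j :> nat.
  rewrite tnth_mktuple inordK // ltnS (leq_trans _ ad) //.
  by rewrite (bigD1 j) //= leq_addr.
have t0in : t0 \in [set t : N.-tuple 'I_d.+1 | (\sum_(i <- t) i <= d)%N].
  by rewrite inE big_tuple (eq_bigr a).
exists (fun t => (t == t0)%:R) => x.
rewrite (bigD1 t0) //= eqxx mul1r big1 ?addr0.
  by apply: eq_bigr => j _; rewrite t0E.
by move=> t /andP[_ /negPf->]; rewrite mul0r.
Qed.

Lemma polyfunD d f g : polyfun d f -> polyfun d g ->
  polyfun d (fun x => f x + g x).
Proof.
move=> [c fE] [c' gE]; exists (fun t => c t + c' t) => x.
by rewrite fE gE -big_split; apply: eq_bigr => t _; rewrite mulrDl.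
Qed.

Lemma polyfunZ d a f : polyfun d f -> polyfun d (fun x => a * f x).
Proof.
move=> [c fE]; exists (fun t => a * c t) => x.
by rewrite fE mulr_sumr; apply: eq_bigr => t _; rewrite mulrA.
Qed.

Lemma polyfun0 d : polyfun d (fun=> 0).
Proof. by exists (fun=> 0) => x; rewrite big1 // => t _; rewrite mul0r. Qed.

Lemma polyfun_sum d (I : Type) (r : seq I) (P : pred I) (F : I -> 'rV[R]_N -> R) :
  (forall i, P i -> polyfun d (F i)) ->
  polyfun d (fun x => \sum_(i <- r | P i) F i x).
Proof.
move=> FP; elim: r => [|i r IHr].
  by apply: polyfun_ext (polyfun0 d) => x; rewrite big_nil.
case Pi: (P i).
  apply: (polyfun_ext _ (polyfunD (FP i Pi) IHr)) => x.
  by rewrite big_cons Pi.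
by apply: (polyfun_ext _ IHr) => x; rewrite big_cons Pi.
Qed.

Lemma polyfun_le d e f : (d <= e)%N -> polyfun d f -> polyfun e f.
Proof.
move=> de [c fE]; apply: (polyfun_ext (fun x => esym (fE x))).
apply: polyfun_sum => t; rewrite inE => td; apply: polyfunZ.
by apply: polyfun_monomial; move: td; rewrite big_tuple => /leq_trans; apply.
Qed.

Lemma polyfunM d e f g : polyfun d f -> polyfun e g ->
  polyfun (d + e) (fun x => f x * g x).
Proof.
move=> [c fE] [c' gE].
pose h (x : 'rV[R]_N) :=
  \sum_(t in [set t : N.-tuple 'I_d.+1 | (\sum_(i <- t) i <= d)%N])
  \sum_(u in [set t : N.-tuple 'I_e.+1 | (\sum_(i <- t) i <= e)%N])
    (c t * c' u) * monomial (fun j => tnth t j + tnth u j)%N x.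
apply: (@polyfun_ext _ h) => [x|].
  rewrite fE gE mulr_suml; apply: eq_bigr => t _.
  rewrite mulr_sumr; apply: eq_bigr => u _; rewrite mulrACA; congr (_ * _).
  by rewrite -big_split; apply: eq_bigr => j _; rewrite exprD.
apply: polyfun_sum => t; rewrite inE => td.
apply: polyfun_sum => u; rewrite inE => ue; apply: polyfunZ.
apply: polyfun_monomial; rewrite big_split /=.
by move: td ue; rewrite !big_tuple; apply: leq_add.
Qed.

Lemma polyfun_cst a : polyfun 0 (fun=> a).
Proof.
apply: (@polyfun_ext _ (fun x => a * monomial (fun=> 0%N) x)).
  by move=> x; rewrite /monomial big1 ?mulr1.
by apply/polyfunZ/polyfun_monomial; rewrite sum_nat_const muln0.
Qed.

Lemma polyfun_coord j : polyfun 1 (fun x => x 0 j).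
Proof.
apply: (@polyfun_ext _ (monomial (fun i => i == j : nat))).
  move=> x; rewrite /monomial (bigD1 j) //= eqxx expr1 big1 ?mulr1 //.
  by move=> i /negPf->.
by apply: polyfun_monomial; rewrite (bigD1 j) //= eqxx big1 // => i /negPf->.
Qed.

Lemma polyfunX d f k : polyfun d f -> polyfun (k * d) (fun x => f x ^+ k).
Proof.
move=> fP; elim: k => [|k IHk]; first exact: (polyfun_cst 1).
rewrite mulSn; apply: (polyfun_ext _ (polyfunM fP IHk)) => x.
by rewrite exprS.
Qed.

Lemma polyfun_prod (I : Type) (r : seq I) (P : pred I) (D : I -> nat)
    (F : I -> 'rV[R]_N -> R) :
  (forall i, P i -> polyfun (D i) (F i)) ->
  polyfun (\sum_(i <- r | P i) D i) (fun x => \prod_(i <- r | P i) F i x).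
Proof.
move=> FP; elim: r => [|i r IHr].
  by rewrite big_nil; apply: polyfun_ext (polyfun_cst 1) => x; rewrite big_nil.
rewrite big_cons; case Pi: (P i).
  apply: (polyfun_ext _ (polyfunM (FP i Pi) IHr)) => x.
  by rewrite big_cons Pi.
by apply: (polyfun_ext _ IHr) => x; rewrite big_cons Pi.
Qed.

(** There are ['C(N + d, N)] monomials, so the coefficient matrix has a nonzero left kernel. *)
Lemma polyfun_dependent d (I : finType) (F : I -> 'rV[R]_N -> R) :
  (forall i, polyfun d (F i)) -> ('C(N + d, N) < #|I|)%N ->
  exists r : I -> R, (exists i, r i != 0) /\
    forall x, \sum_i r i * F i x = 0.
Proof.
move=> /choice[c FE] ltI.
pose S := [set t : N.-tuple 'I_d.+1 | (\sum_(i <- t) i <= d)%N].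
pose A := \matrix_(i < #|I|, j < #|S|) c (enum_val i) (enum_val j).
have : (0 < \rank (kermx A))%N.
  rewrite mxrank_ker subn_gt0 (leq_ltn_trans (rank_leq_col _)) //.
  by rewrite card_partial_ord_partitions.
rewrite lt0n mxrank_eq0 => /rowV0Pn[v /sub_kermxP vA v0].
have [j vj] : exists j, v 0 j != 0.
  apply/existsP; apply: contraNT v0 => /existsPn v0.
  by apply/eqP/rowP => j; rewrite mxE; apply/eqP; move: (v0 j); rewrite negbK.
exists (fun i => v 0 (enum_rank i)); split.
  by exists (enum_val j); rewrite enum_valK.
move=> x.
transitivity (\sum_(t in S) (\sum_i v 0 (enum_rank i) * c i t) *
    monomial (fun j => tnth t j) x).
  under eq_bigr do rewrite FE mulr_sumr.
  rewrite exchange_big; apply: eq_bigr => t _; rewrite mulr_suml.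
  by apply: eq_bigr => i _; rewrite mulrA.
rewrite big1 // => t tS; apply/eqP; rewrite mulf_eq0; apply/orP; left.
apply/eqP; have /rowP/(_ (enum_rank_in tS t)) := vA; rewrite !mxE; apply: etrans.
rewrite (reindex (@enum_val I I)) /=; last first.
  exists enum_rank => i _; [exact: enum_valK | exact: enum_rankK].
by apply: eq_bigr => i _; rewrite mxE enum_valK enum_rankK_in.
Qed.

End PolynomialFunctions.

(** * Bounding the solutions of a polynomial system with generic parameters *)

Lemma poly_nonroot (R : idomainType) (p : {poly R}) (u : nat -> R) (A : nat) :
  injective u -> p != 0 -> (size p <= A)%N -> exists2 a, (a < A)%N & p.[u a] != 0.
Proof.
move=> u_inj p0 pA; have [|/allPn[x]] := boolP (all (root p) (map u (iota 0 A))).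
  move=> rootA; have := max_poly_roots p0 rootA.
  by rewrite map_inj_uniq ?iota_uniq // size_map size_iota ltnNge pA => /(_ isT).
by case/mapP => a; rewrite mem_iota => aA -> pa; exists a.
Qed.

Lemma natr_inj (R : numDomainType) : injective (fun a => a%:R : R).
Proof. by move=> a b /eqP; rewrite eqr_nat => /eqP. Qed.

Lemma base_digits b N e : (0 < b)%N -> (e < b ^ N)%N ->
  (\sum_(j < N) (e %/ b ^ j) %% b * b ^ j)%N = e.
Proof.
move=> b0; elim: N e => [|N IHN] e eN.
  by rewrite big_ord0; case: e eN.
rewrite big_ord_recl expn0 divn1 muln1 [RHS](divn_eq _ b) addnC; congr (_ + _)%N.
have /IHN <- : (e %/ b < b ^ N)%N by rewrite ltn_divLR // -expnSr.
rewrite big_distrl; apply: eq_bigr => j _.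
by rewrite lift0 expnS divnMA /= -mulnA (mulnC b).
Qed.

(** For two distinct points the difference of the values is a nonzero polynomial in [a]. The bound
    on [a] does not depend on [X], so generic parameters can be fixed for all candidates [a] before
    the points are known. *)
Lemma separating_functional (R : numDomainType) N K (X : 'I_K -> 'rV[R]_N) :
  injective X -> exists2 a, (a < (K * K * N).+1)%N &
    injective (fun k => \sum_(j < N) a%:R ^+ j * X k 0 j).
Proof.
move=> X_inj.
pose q (u : 'I_K * 'I_K) := \poly_(j < N) \sum_(i < N | i == j :> nat) (X u.1 0 i - X u.2 0 i).
have qE u a : (q u).[a] = \sum_(j < N) a ^+ j * X u.1 0 j - \sum_(j < N) a ^+ j * X u.2 0 j.
  rewrite horner_poly -sumrB; apply: eq_bigr => j _.
  rewrite (big_pred1 j) => [|i]; last by rewrite /= -val_eqE.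
  by rewrite mulrC mulrBr.
have q0 u : u.1 != u.2 -> q u != 0.
  apply: contra => /eqP qu; apply/eqP/X_inj/rowP => j.
  have /(congr1 (fun p : {poly R} => p`_j)) := qu.
  rewrite coef_poly ltn_ord coef0 (big_pred1 j) => [|i]; last by rewrite /= -val_eqE.
  by move/eqP; rewrite subr_eq0 => /eqP.
pose Q := \prod_(u | u.1 != u.2) q u.
have Q0 : Q != 0 by apply/prodf_neq0 => u; exact: q0.
have sQ : (size Q <= (K * K * N).+1)%N.
  apply: leq_trans (size_prod_leq _ _) _; apply: leq_trans (leq_subr _ _) _.
  rewrite ltnS; apply: (@leq_trans (\sum_(u : 'I_K * 'I_K) N)); last first.
    by rewrite sum_nat_const card_prod !card_ord.
  rewrite big_mkcond; apply: leq_sum => u _.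
  by case: ifP => // _; exact: size_poly.
have [a aA] := poly_nonroot (@natr_inj R) Q0 sQ.
rewrite horner_prod => /prodf_neq0 Qa; exists a => // k l /eqP kl.
apply/eqP; apply: contraT => neq_kl.
by have := Qa (k, l) neq_kl; rewrite qE /= subr_eq0 kl.
Qed.

(** If [K] is too large, counting monomials forces a linear relation between products of powers of a
    linear form [h], below the power [K], with powers of the [P j] and [F j]. On a fibre, where
    [P j = c j * F j], it becomes a polynomial in [h] of degree below [K], nonzero for generic [c],
    yet with [K] distinct roots. *)
Lemma polyfun_fiber_bound (R : realType) N K D (P F : 'I_N -> 'rV[R]_N -> R) :
  (forall j, polyfun D (P j)) -> (forall j, polyfun D (F j)) ->
  (forall c : 'I_N -> R, exists2 X : 'I_K -> 'rV[R]_N, injective X &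
     forall k j, F j (X k) != 0 /\ P j (X k) = c j * F j (X k)) ->
  (K * N`! <= (N * D).+1 ^ N)%N.
Proof.
move=> polyP polyF fiber; rewrite leqNgt; apply/negP => ltK.
(* The value of [T] below makes [N + d] equal to [T * (N * D).+1], so that the comparison of
   dimensions reduces to [ltK]. *)
have K0 : (0 < K)%N by case: (K) ltK.
pose T := (N + K)%N; pose b := T.+1; pose A := (K * K * N).+1.
pose d := (K + N * (T * D))%N.
pose dig (e j : nat) := ((e %/ b ^ j) %% b)%N.
have digT e j : (dig e j <= T)%N by rewrite -ltnS ltn_mod.
have ltd : ('C(N + d, N) < #|{: 'I_(b ^ N) * 'I_K}|)%N.
  rewrite card_prod !card_ord -(ltn_pmul2r (fact_gt0 N)) bin_ffact.
  apply: (@leq_ltn_trans ((T * (N * D).+1) ^ N)).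
    have ffactX n m : (n ^_ m <= n ^ m)%N.
      rewrite ffact_prod -[X in (_ <= _ ^ X)%N](card_ord m) -prod_nat_const.
      by apply: leq_prod => i _; exact: leq_subr.
    by apply: leq_trans (ffactX _ _) _; rewrite leq_expl // /d addnA mulnS mulnCA.
  rewrite expnMn -mulnA; apply: (@leq_ltn_trans (b ^ N * (N * D).+1 ^ N)).
    by rewrite leq_mul2r leq_expl ?orbT.
  by rewrite ltn_pmul2l ?expn_gt0.
pose h (a : nat) (x : 'rV[R]_N) := \sum_(j < N) a%:R ^+ j * x 0 j.
(* The powers of [F j] homogenise: on a fibre every [G a u] is the common factor
   [\prod_j F j x ^+ T] times a power of [h] and a monomial in [c]. *)
pose G a (u : 'I_(b ^ N) * 'I_K) x :=
  h a x ^+ u.2 * \prod_j (P j x ^+ dig u.1 j * F j x ^+ (T - dig u.1 j)).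
have polyG a u : polyfun d (G a u).
  apply: polyfunM.
    apply: (@polyfun_le _ _ (u.2 * 1)); first by rewrite muln1 ltnW.
    apply/polyfunX/polyfun_sum => j _; exact/polyfunZ/polyfun_coord.
  have -> : (N * (T * D) = \sum_(j < N) (dig u.1 j * D + (T - dig u.1 j) * D))%N.
    rewrite (eq_bigr (fun=> T * D)%N) ?sum_nat_const ?card_ord // => j _.
    by rewrite -mulnDl subnKC.
  by apply: polyfun_prod => j _; apply: polyfunM; exact: polyfunX.
have /choice[r rP] a := polyfun_dependent (polyG a) ltd.
have /choice[k0 k0P] : forall a, exists k : 'I_K,
    \poly_(e < b ^ N) (if insub e is Some e' then r a (e', k) else 0) != 0.
  move=> a; have [[[e k] rek] _] := rP a; exists k.
  apply: contra rek => /eqP /(congr1 (fun p : {poly R} => p`_e)).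
  by rewrite coef_poly ltn_ord valK coef0 => ->.
pose q a k := \poly_(e < b ^ N) (if insub e is Some e' then r a (e', k) else 0).
(* The product over all [a < A] makes one [s] good for whichever functional turns out to separate
   the points. *)
have Q0 : \prod_(a < A) q a (k0 a) != 0 by apply/prodf_neq0 => a _; exact: k0P.
have [s _] := poly_nonroot (@natr_inj R) Q0 (leqnn _).
rewrite horner_prod => /prodf_neq0 qs.
(* Kronecker substitution: with c_j = s^(b^j) the monomial of c with the base-b
   digits of e as exponents is s^e, so one non-root s is a generic parameter. *)
have [X X_inj XP] := fiber (fun j => s%:R ^+ (b ^ j)).
have [a aA h_inj] := separating_functional X_inj.
pose p := \poly_(k < K) (if insub k is Some k' then (q a k').[s%:R] else 0).
have p0 : p != 0.
  apply: contra (qs (Ordinal aA) isT) => /eqP.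
  move=> /(congr1 (fun p : {poly R} => p`_(k0 a))).
  by rewrite coef_poly ltn_ord valK coef0 => ->.
have := @max_poly_roots _ p [seq h a (X k) | k <- enum 'I_K] p0.
rewrite size_map size_enum_ord map_inj_uniq ?enum_uniq //.
suff -> : all (root p) [seq h a (X k) | k <- enum 'I_K].
  by move=> /(_ isT isT); rewrite ltnNge size_poly.
apply/allP => _ /mapP[k _ ->]; apply/eqP.
have F0 : \prod_j F j (X k) ^+ T != 0.
  by apply/prodf_neq0 => j _; rewrite expf_neq0 // (XP k j).1.
apply: (mulIf F0); rewrite mul0r -((rP a).2 (X k)).
rewrite horner_poly mulr_suml [RHS](eq_bigr (fun u => r a (u.1, u.2) * G a (u.1, u.2) (X k)));
  last by case.
rewrite -(pair_bigA _ (fun e k' => r a (e, k') * G a (e, k') (X k))) exchange_big /=.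
apply: eq_bigr => k' _; rewrite valK horner_poly !mulr_suml.
apply: eq_bigr => e _; rewrite valK -!mulrA; congr (_ * _).
rewrite /G /= mulrCA; congr (_ * _).
rewrite -{1}(base_digits (isT : (0 < b)%N) (ltn_ord e)) expr_sum -big_split /=.
apply: eq_bigr => j _; rewrite (XP k j).2 exprMn -mulrA -exprD subnKC //.
by rewrite -exprM mulnC.
Qed.

(** * Continuity and growth of polynomial functions *)

Section Continuity.
Import classical_sets topology normedtype derive realfun.
Import numFieldNormedType.Exports.

Variables (R : realType) (N : nat).
Implicit Types f g : 'rV[R]_N -> R.

Lemma polyfun_continuous d f : polyfun d f -> continuous f.
Proof.
case=> c fE; have -> : f = fun x => \sum_(t in [set t : N.-tuple 'I_d.+1 |
  (\sum_(i <- t) i <= d)%N]%SET) c t * monomial (fun j => tnth t j) x.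
  exact/funext.
apply: (continuous_big (@add_continuous R)) => t _ x; apply: continuousM; first exact: cst_continuous.
apply: (continuous_big (@mul_continuous R)) => j _ {}x.
exact: (continuous_comp (@coord_continuous _ _ _ _ _ _) (@exprn_continuous _ _ _)).
Qed.

Lemma polyfun_growth d f : polyfun d f ->
  exists2 C : R, 0 <= C & forall x, `|f x| <= C * (1 + \sum_j `|x 0 j|) ^+ d.
Proof.
case=> c fE; exists (\sum_(t in [set t : N.-tuple 'I_d.+1 |
  (\sum_(i <- t) i <= d)%N]%SET) `|c t|); first exact: sumr_ge0.
move=> x; rewrite fE mulr_suml; apply: le_trans (ler_norm_sum _ _ _) _.
apply: ler_sum => t; rewrite inE => td; rewrite normrM ler_wpM2l // normr_prod.
set u := 1 + _; have u1 : 1 <= u by rewrite lerDl sumr_ge0.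
apply: (@le_trans _ _ (\prod_(j < N) u ^+ tnth t j)).
  apply: ler_prod => j _; rewrite normr_ge0 normrX lerXn2r ?nnegrE //.
    exact: le_trans u1.
  by rewrite /u (bigD1 j) //= addrCA lerDl addr_ge0 ?sumr_ge0.
by rewrite -expr_sum ler_weXn2l // -(big_tuple _ _ t xpredT (fun i => i : nat)).
Qed.

End Continuity.

(** * A critical point in every sign cell *)

Section CriticalPoint.
Import classical_sets topology normedtype derive realfun.
Import numFieldNormedType.Exports.

Variables (R : realType) (N : nat) (I : finType).
Variables (f : I -> 'rV[R]_N -> R) (df : I -> 'I_N -> 'rV[R]_N -> R) (d : nat).
Hypothesis f_poly : forall i, polyfun d (f i).
Hypothesis f_affine : forall i j x t,
  f i (x + t *: delta_mx 0 j) = f i x + t * df i j x.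
Variables (c : 'I_N -> R) (y : 'rV[R]_N).
Hypothesis fy : forall i, f i y != 0.

Let u i x := f i x * f i y.
Let E (x : 'rV[R]_N) := \sum_j (x 0 j ^+ 2 / 2 + c j * x 0 j).
(* The factor u + |u| vanishes outside the cell of [y], so no constraint is
   needed when maximising. *)
Let Psi x := \prod_i (u i x + `|u i x|) * expR (- E x).

Let Psi_y_gt0 : 0 < Psi y.
Proof.
rewrite mulr_gt0 ?expR_gt0 //; apply: prodr_gt0 => i _.
have ? : 0 < u i y by rewrite /u -expr2 exprn_even_gt0 //= fy.
by rewrite addr_gt0 // normr_gt0 gt_eqF.
Qed.

Let u_poly i : polyfun d (u i).
Proof. by apply: polyfun_ext (polyfunZ (f i y) (f_poly i)) => x; rewrite mulrC. Qed.

Let Psi_continuous : continuous Psi.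
Proof.
have sqE : continuous E.
  apply: (@polyfun_continuous _ _ 2).
  apply: polyfun_sum => j _; apply: polyfunD.
    apply: (polyfun_ext _ (polyfunZ 2^-1 (polyfunX 2 (polyfun_coord R j)))).
    by move=> x; rewrite mulrC.
  exact: polyfunZ (polyfun_le _ (polyfun_coord _ _)).
move=> x.
apply: (@continuousM _ _ (fun x => \prod_i (u i x + `|u i x|)) (fun x => expR (- E x))).
  apply: (continuous_big (@mul_continuous R)) => i _ {}x.
  have cu : {for x, continuous (u i)} by exact: (polyfun_continuous (u_poly i)).
  apply: continuousD => //.
  by apply: (continuous_comp cu); exact: norm_continuous.
apply: (@continuous_comp _ _ _ (fun x => - E x) expR); last exact: continuous_expR.
by apply: continuousN; exact: sqE.
Qed.

(** Completing squares gives [E x >= w - (B + 1)], while the product grows at most like [w ^+ m]. As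
    [expR w] exceeds [w ^+ m.+1] over a factorial, [Psi x] is at most a constant divided by [w]. *)
Let Psi_coercive : exists2 r : R, 0 <= r &
  forall x : 'rV[R]_N, (exists j, r < `|x 0 j|) -> Psi x < Psi y.
Proof.
have /(polyfun_growth)[C C0 prodC] :=
  polyfun_prod (index_enum I) (fun i (_ : true) => u_poly i).
set m := (\sum_(i <- _ | _) _)%N in prodC.
pose B := \sum_j (1 + `|c j|) ^+ 2 / 2.
have B0 : 0 <= B by apply: sumr_ge0 => j _; rewrite divr_ge0 // sqr_ge0.
pose M := 2 ^+ #|I| * C * expR (B + 1) * m.+1`!%:R.
have M0 : 0 <= M by rewrite !mulr_ge0 ?expR_ge0 ?exprn_ge0 ?ler0n.
exists (M / Psi y); first by rewrite divr_ge0 // ltW.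
move=> x [j xj]; pose w := 1 + \sum_j `|x 0 j|.
have w1 : 1 <= w by rewrite lerDl sumr_ge0.
have w0 : 0 < w by apply: lt_le_trans w1.
have Mw : M < Psi y * w.
  rewrite mulrC -ltr_pdivrMr //; apply: lt_le_trans xj _.
  by rewrite /w (bigD1 j) //= addrCA lerDl addr_ge0 // sumr_ge0.
have Ew : w - (B + 1) <= E x.
  have -> : w - (B + 1) = \sum_j `|x 0 j| - B by rewrite /w; ring.
  rewrite /B -sumrB; apply: ler_sum => k _.
  have := sqr_ge0 (`|x 0 k| - (1 + `|c k|)); have := real_normK (num_real (x 0 k)).
  have : - (`|c k| * `|x 0 k|) <= c k * x 0 k by rewrite -normrM lerNl -normrN ler_norm.
  move: (c k * _) (x 0 k ^+ 2) => p q; rewrite -[`|c k|]/(`|c k|).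
  move: `|c k| `|x 0 k| => a b; rewrite !expr2; nra.
have expw : w ^+ m.+1 / m.+1`!%:R <= expR w.
  by apply: le_trans (expR_ge1Dxn m (ltW w0)); rewrite lerDr.
have prodw : \prod_i (u i x + `|u i x|) <= 2 ^+ #|I| * (C * w ^+ m).
  apply: (@le_trans _ _ (\prod_i (2 * `|u i x|))).
    apply: ler_prod => i _; rewrite mulr_natl mulr2n lerD ?ler_norm ?andbT //.
    by rewrite -lerBlDl sub0r -normrN ler_norm.
  by rewrite big_split /= prodr_const ler_wpM2l ?exprn_ge0 // -normr_prod prodC.
apply: (@le_lt_trans _ _ (2 ^+ #|I| * (C * w ^+ m) * expR (B + 1) / expR w)).
  rewrite -mulrA ler_pM ?expR_ge0 //.
    by apply: prodr_ge0 => i _; rewrite -lerBlDl sub0r -normrN ler_norm.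
  by rewrite -expRN -expRD ler_expR; lra.
rewrite ltr_pdivrMr ?expR_gt0 //.
apply: lt_le_trans (ler_wpM2l (ltW Psi_y_gt0) expw).
rewrite [ltRHS]mulrA ltr_pdivlMr ?ltr0n ?fact_gt0 // exprS.
have -> : 2 ^+ #|I| * (C * w ^+ m) * expR (B + 1) * m.+1`!%:R = M * w ^+ m.
  by rewrite /M; ring.
by rewrite mulrA ltr_pM2r ?exprn_gt0.
Qed.

(** By coercivity [Psi] has a maximiser, and positivity puts it into the cell of [y]. There [s] is
    the logarithmic derivative of [Psi] along coordinate [j]. Each [f i] is affine on that line, so
    elementary bounds on [expR] replace differentiation. *)
Lemma critical_point_exists : exists x,
  (forall i, 0 < f i x * f i y) /\
  forall j, \sum_i df i j x / f i x = x 0 j + c j.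
Proof.
have [r r0 coercive] := Psi_coercive.
pose K := [set v : 'rV[R]_N | forall j, (`[- r, r]%classic : set R) (v ord0 j)]%classic.
have cK : compact K by apply: (@rV_compact _ _ (fun=> `[- r, r]%classic)) => j; exact: segment_compact.
have notK v : ~ K v -> Psi v < Psi y.
  move=> nK; apply: coercive; apply: contrapT => nr; apply: nK => j /=.
  rewrite in_itv /= -ler_norml leNgt; apply/negP => rj; apply: nr; by exists j.
have Ky : K y by apply: contrapT => /notK; rewrite ltxx.
have [x xK maxK] : exists2 x, x \in K & forall v : 'rV[R]_N, v \in K -> Psi v <= Psi x.
  apply: EVT_max_rV cK _; first by exists y.
  exact: continuous_subspaceT.
have maxx v : Psi v <= Psi x.
  have [vK|/notK/ltW vy] := pselect (K v); first by apply: maxK; rewrite inE.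
  by apply: le_trans vy _; apply: maxK; rewrite inE.
have Px : 0 < Psi x by apply: lt_le_trans (maxx y).
have ux i : 0 < u i x.
  rewrite ltNge; apply/negP => ui; move: Px; rewrite /Psi (bigD1 i) //=.
  by rewrite ler0_norm // subrr !mul0r ltxx.
exists x; split=> // j.
have fx i : f i x != 0 by apply: contraTneq (ux i) => fi; rewrite /u fi mul0r ltxx.
pose al i := df i j x / f i x.
pose s := \sum_i al i - (x 0 j + c j).
pose B := 2 * \sum_i al i ^+ 2 + 1 / 2.
have B0 : 0 < B by rewrite ltr_wpDl ?divr_gt0 // mulr_ge0 // sumr_ge0 // => i _; exact: sqr_ge0.
have small t : (forall i, `|t * al i| <= 1 / 2) -> t * s <= t ^+ 2 * B.
  move=> tal; pose v := x + t *: delta_mx 0 j.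
  have uv i : u i v = u i x * (1 + t * al i).
    by rewrite /u f_affine /al; field.
  have al1 i : 1 / 2 <= 1 + t * al i by have := tal i; rewrite ler_norml => /andP[]; lra.
  have Ev : E v = E x + (t * (x 0 j + c j) + t ^+ 2 / 2).
    rewrite /E (bigD1 j) //= [in RHS](bigD1 j) //= !mxE !eqxx mulr1.
    rewrite (eq_bigr (fun k => x 0 k ^+ 2 / 2 + c k * x 0 k)); first by field.
    by move=> k kj; rewrite !mxE (negPf kj) mulr0 addr0.
  have := maxx v; rewrite /Psi Ev opprD expRD.
  have -> : \prod_i (u i v + `|u i v|) = \prod_i (u i x + `|u i x|) * \prod_i (1 + t * al i).
    rewrite -big_split; apply: eq_bigr => i _ /=; have := al1 i => ?.
    by rewrite uv normrM (@ger0_norm _ (1 + _)) ?mulrDl //; lra.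
  rewrite mulrACA -/(Psi x) ger_pMr // mulrC => le1.
  (* 1 + w >= exp (w - 2 w^2) for |w| <= 1/2 *)
  have : expR (\sum_i (t * al i - 2 * (t * al i) ^+ 2)) <= \prod_i (1 + t * al i).
    rewrite expR_sum; apply: ler_prod => i _; rewrite expR_ge0 /=.
    have := expR_ge1Dx (- (t * al i - 2 * (t * al i) ^+ 2)); rewrite expRN.
    have := expR_gt0 (t * al i - 2 * (t * al i) ^+ 2).
    move: (t * al i) (al1 i) (tal i) => w w1; rewrite ler_norml => /andP[_ w2].
    move: (expR _) => e e0; rewrite -[e^-1]mul1r ler_pdivlMr // => we.
    have : (1 - w + 2 * w ^+ 2) * (1 + w) >= 1 by rewrite !expr2; nra.
    have ? : 0 < 1 - w + 2 * w ^+ 2 by rewrite expr2; nra.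
    move=> ge1; rewrite -(@ler_pM2l _ (1 - w + 2 * w ^+ 2)) //.
    by apply: le_trans ge1; apply: le_trans we; rewrite ler_pM2r //; lra.
  move/(ler_wpM2l (expR_ge0 (- (t * (x 0 j + c j) + t ^+ 2 / 2)))).
  move/le_trans/(_ le1); rewrite -expRD expR_le1.
  rewrite big_split /= -mulr_sumr sumrN.
  have -> : \sum_i 2 * (t * al i) ^+ 2 = t ^+ 2 * (2 * \sum_i al i ^+ 2).
    by rewrite mulr_sumr mulr_sumr; apply: eq_bigr => i _; rewrite exprMn mulrCA.
  by rewrite /s /B; lra.
suff /eqP : s = 0 by rewrite subr_eq0 => /eqP.
pose S : R := \sum_i `|al i|.
have S0 : 0 <= S by exact: sumr_ge0.
(* So small that [t = e * s] is admissible in [small] and that [e * B < 1]; then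
   [t * s <= t ^+ 2 * B] forces [s = 0]. *)
pose e := (2 * (1 + B) * (1 + `|s|) * (1 + S))^-1.
have q0 : 0 < 2 * (1 + B) * (1 + `|s|) * (1 + S).
  by rewrite !mulr_gt0 // ?ltr_wpDr // ltW.
have e0 : 0 < e by rewrite invr_gt0.
have : forall i, `|e * s * al i| <= 1 / 2.
  move=> i; rewrite 2!normrM (gtr0_norm e0) -mulrA mulrC ler_pdivrMr //.
  have : `|al i| <= S by rewrite /S (bigD1 i) //= lerDl sumr_ge0.
  move: `|s| (normr_ge0 s) `|al i| (normr_ge0 (al i)) => a a0 b b0 bS.
  have : a * b <= (1 + a) * (1 + S) by rewrite ler_pM //; lra.
  have : 0 <= B * ((1 + a) * (1 + S))
    by exact: mulr_ge0 (ltW B0) (mulr_ge0 (addr_ge0 ler01 a0) (addr_ge0 ler01 S0)).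
  by lra.
move/small; apply: contraTeq => s0; rewrite -ltNge.
have s2 : 0 < s ^+ 2 by rewrite exprn_even_gt0.
have -> : e * s * s = e * s ^+ 2 by ring.
have -> : (e * s) ^+ 2 * B = e * s ^+ 2 * (e * B) by ring.
have es2 : 0 < e * s ^+ 2 by exact: mulr_gt0.
rewrite -[ltRHS]mulr1 ltr_pM2l //.
rewrite mulrC ltr_pdivrMr // mul1r.
have : (1 + B) * 1 <= (1 + B) * ((1 + `|s|) * (1 + S)).
  apply: ler_wpM2l; first by apply: addr_ge0 => //; exact: ltW.
  rewrite -[leLHS]mul1r; apply: ler_pM => //; first by rewrite lerDl.
  by rewrite lerDl.
by lra.
Qed.

End CriticalPoint.

(** Clearing denominators one coordinate at a time costs degree [2 * s + 1] only, however large [I]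
    is. Critical points of distinct cells are distinct because they carry the signs of their
    cells. *)
Lemma sign_patterns_bound (R : realType) (N s : nat) (I : finType)
    (f : I -> 'rV[R]_N -> R) (df : I -> 'I_N -> 'rV[R]_N -> R)
    (J : 'I_N -> {set I}) (S : {set {ffun I -> bool}}) :
  (forall i, polyfun 2 (f i)) -> (forall i j, polyfun 1 (df i j)) ->
  (forall i j x t, f i (x + t *: delta_mx 0 j) = f i x + t * df i j x) ->
  (forall i j x, i \notin J j -> df i j x = 0) ->
  (forall j, (#|J j| <= s)%N) ->
  (forall sg, sg \in S -> exists x, forall i, f i x != 0 /\ sg i = (0 < f i x)) ->
  (#|S| * N`! <= (N * (2 * s).+1).+1 ^ N)%N.
Proof.
move=> f_poly df_poly f_affine dfJ Js SP.
(* [P j = c j * F j] is the critical point equation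
   sum_i df i j / f i = x j + c j, multiplied by F j. *)
pose F (j : 'I_N) x := \prod_(i in J j) f i x.
pose P (j : 'I_N) x :=
  \sum_(i in J j) df i j x * \prod_(i' in J j :\ i) f i' x + (-1) * (x 0 j * F j x).
have prod_poly (A : {set I}) : polyfun (#|A| * 2) (fun x => \prod_(i in A) f i x).
  by rewrite -sum_nat_const; apply: polyfun_prod.
have polyF j : polyfun (2 * s) (F j).
  by apply: polyfun_le (prod_poly _); rewrite mulnC leq_mul2l Js.
apply: (@polyfun_fiber_bound _ _ _ _ P F).
- move=> j; apply: polyfunD; last first.
    apply: polyfunZ; apply: (@polyfunM _ _ 1 (2 * s)) (polyF j).
    exact: polyfun_coord.
  apply: polyfun_sum => i iJ; apply: (@polyfun_le _ _ (1 + #|J j :\ i| * 2)).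
    have := Js j; rewrite (cardsD1 i (J j)) iJ; lia.
  by apply: polyfunM.
- by move=> j; apply: polyfun_le (polyF j).
move=> c.
have /choice[y yP] : forall k : 'I_#|S|, exists x, forall i,
    f i x != 0 /\ enum_val k i = (0 < f i x).
  by move=> k; apply: SP; exact: enum_valP.
have /choice[X XP] k := critical_point_exists f_poly f_affine c (fun i => (yP k i).1).
exists X.
  move=> k l Xkl; apply/enum_val_inj/ffunP => i.
  rewrite (yP k i).2 (yP l i).2.
  have := (XP k).1 i; have := (XP l).1 i; rewrite Xkl; nra.
move=> k j.
have fX i : f i (X k) != 0 by apply: contraTneq ((XP k).1 i) => ->; rewrite mul0r ltxx.
split; first by apply/prodf_neq0.
have := (XP k).2 j; move/(congr1 (fun u => u * F j (X k))).
rewrite (bigID (fun i => i \in J j)) /= addrC big1 ?add0r; last first.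
  by move=> i iJ; rewrite dfJ // mul0r.
rewrite mulr_suml mulrDl => E; rewrite /P mulN1r; apply/eqP.
rewrite subr_eq addrC -E; apply/eqP; apply: eq_bigr => i iJ.
rewrite [F _ _](bigD1 i) //= -mulrA mulKf //; congr (_ * _).
by apply: eq_bigl => i'; rewrite !inE andbC.
Qed.

(** The falling factorial of [N + N] lies above [N ^ N] and equals the central binomial coefficient,
    at most [4 ^ N], times the factorial. *)
Lemma expn_fact_bound N : (N ^ N <= 4 ^ N * N`!)%N.
Proof.
have le1 : (N ^ N <= (N + N) ^_ N)%N.
  rewrite ffact_prod -[X in (_ ^ X <= _)%N](card_ord N) -prod_nat_const.
  by apply: leq_prod => i _; have := ltn_ord i; lia.
apply: leq_trans le1 _; rewrite -bin_ffact leq_mul2r; apply/orP; right.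
have -> : (4 ^ N = 2 ^ (N + N))%N by rewrite -[4%N]/(2 ^ 2)%N -expnM mul2n addnn.
rewrite -[(2 ^ _)%N]/((1 + 1) ^ (N + N))%N expnDn.
have ltN : (N < (N + N).+1)%N by rewrite ltnS leq_addr.
by rewrite (bigD1 (Ordinal ltN)) //= !exp1n !muln1 leq_addr.
Qed.

(** * The number of order types *)

Section OrderTypes.
Variables (R : realType) (V : finType).

(** A coordinate occurs only in the orientations of triples through its vertex, at most [3 * n ^ 2]
    of them. Division by the factorial then saves a factor [N / 4] per coordinate, which leaves
    [32 * n ^ 2]. *)
Lemma order_types_bound (S : {set {ffun V * V * V -> bool}}) :
  (forall sg, sg \in S -> exists2 p : V -> 'rV[R]_2, general_position p & sg = order_type p) ->
  (#|S| <= (32 * #|V| ^ 2) ^ (2 * #|V|))%N.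
Proof.
move=> SP; set n := #|V|.
pose N := #|{: V * 'I_2}|.
have NE : N = (2 * n)%N by rewrite /N card_prod card_ord mulnC.
pose co (v : V) (k : 'I_2) : 'I_N := enum_rank (v, k).
pose de (v : V) (k : 'I_2) (j : 'I_N) : R := (co v k == j)%:R.
pose dis (t : V * V * V) := [&& t.1.1 != t.1.2, t.1.1 != t.2 & t.1.2 != t.2].
pose df t j (x : 'rV[R]_N) : R := if dis t then
    (x 0 (co t.1.2 0) - x 0 (co t.1.1 0)) * (de t.2 1 j - de t.1.1 1 j) +
    (de t.1.2 0 j - de t.1.1 0 j) * (x 0 (co t.2 1) - x 0 (co t.1.1 1)) -
    (x 0 (co t.2 0) - x 0 (co t.1.1 0)) * (de t.1.2 1 j - de t.1.1 1 j) -
    (de t.2 0 j - de t.1.1 0 j) * (x 0 (co t.1.2 1) - x 0 (co t.1.1 1)) else 0.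
pose f t (x : 'rV[R]_N) : R := if dis t then
    (x 0 (co t.1.2 0) - x 0 (co t.1.1 0)) * (x 0 (co t.2 1) - x 0 (co t.1.1 1)) -
    (x 0 (co t.2 0) - x 0 (co t.1.1 0)) * (x 0 (co t.1.2 1) - x 0 (co t.1.1 1))
  else -1.
(* On degenerate triples f is -1 to match [order_type], which is false there. *)
pose J (j : 'I_N) : {set V * V * V} :=
  [set t | [|| t.1.1 == (enum_val j).1, t.1.2 == (enum_val j).1
             | t.2 == (enum_val j).1]].
have dif_poly i j : polyfun 1 (fun x : 'rV[R]_N => x 0 i - x 0 j).
  apply: (polyfun_ext _ (polyfunD (polyfun_coord _ i) (polyfunZ (-1) (polyfun_coord _ j)))).
  by move=> x; rewrite mulN1r.
have subP (m : nat) (g h : 'rV[R]_N -> R) : polyfun m g -> polyfun m h -> polyfun m (fun x => g x - h x).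
  move=> gP hP; apply: (polyfun_ext _ (polyfunD gP (polyfunZ (-1) hP))).
  by move=> x; rewrite mulN1r.
have f_poly t : polyfun 2 (f t).
  rewrite /f; case: (dis t); last exact: polyfun_le (polyfun_cst _ _).
  by apply: subP; apply: (@polyfunM _ _ 1 1).
have df_poly t j : polyfun 1 (df t j).
  rewrite /df; case: (dis t); last exact: polyfun0.
  have rP e g : polyfun 1 g -> polyfun 1 (fun x : 'rV[R]_N => g x * e).
    by move=> gP; apply: polyfun_ext (polyfunZ e gP) => x; rewrite mulrC.
  apply: (subP); first apply: (subP); first apply: polyfunD;
    by [exact: rP | exact: polyfunZ].
(* [orient] multiplies first coordinates by second coordinates only, so it is affine in each single
   variable. *)
have f_affine t j x u : f t (x + u *: delta_mx 0 j) = f t x + u * df t j x.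
  rewrite /f /df; case: (dis t); last by rewrite mulr0 addr0.
  have xE v k : (x + u *: delta_mx 0 j) 0 (co v k) = x 0 (co v k) + u * de v k j.
    by rewrite !mxE.
  have de0 v w : de v 0 j * de w 1 j = 0.
    rewrite /de -natrM mulnb; case: eqP => // <-; case: eqP => //.
    by move/enum_rank_inj.
  rewrite !xE.
  move: (de0 t.1.2 t.2) (de0 t.1.2 t.1.1) (de0 t.1.1 t.2) (de0 t.1.1 t.1.1).
  move: (de0 t.2 t.1.2) (de0 t.2 t.1.1) (de0 t.1.1 t.1.2).
  move: (de t.2 0 j) (de t.2 1 j) (de t.1.2 0 j) (de t.1.2 1 j) (de t.1.1 0 j) (de t.1.1 1 j).
  move: (x 0 _) (x 0 _) (x 0 _) (x 0 _) (x 0 _) (x 0 _).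
  move=> x1 x2 x3 x4 x5 x6 d1 d2 d3 d4 d5 d6 h1 h2 h3 h4 h5 h6 h7.
  have e1 : (d3 - d5) * (d2 - d6) = 0 by rewrite mulrBl !mulrBr h4 h5 h6 h7 !subrr.
  have e2 : (d1 - d5) * (d4 - d6) = 0 by rewrite mulrBl !mulrBr h1 h2 h3 h7 !subrr.
  apply/eqP; rewrite -subr_eq0; apply/eqP.
  transitivity (u ^+ 2 * ((d3 - d5) * (d2 - d6) - (d1 - d5) * (d4 - d6))); first by ring.
  by rewrite e1 e2 subrr mulr0.
have dfJ t j x : t \notin J j -> df t j x = 0.
  rewrite inE !negb_or /df => /and3P[t1 t2 t3]; case: (dis t) => //.
  have de0 v k : v != (enum_val j).1 -> de v k j = 0.
    move=> vj; rewrite /de; case: eqP => // E; case/eqP: vj.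
    by rewrite -E enum_rankK.
  by rewrite !de0 // !subrr !mulr0 !mul0r !subr0 addr0.
have Js j : (#|J j| <= 3 * n ^ 2)%N.
  set w := (enum_val j).1.
  pose T (h : V * V -> V * V * V) := h @: [set: V * V]%SET.
  have cT h : (#|T h| <= n ^ 2)%N.
    by apply: leq_trans (leq_imset_card _ _) _; rewrite cardsT card_prod mulnn.
  have : (J j \subset T (fun u => (w, u.1, u.2)) :|: T (fun u => (u.1, w, u.2))
      :|: T (fun u => (u.1, u.2, w)))%SET.
    apply/subsetP => -[[a b] c]; rewrite !inE /= -orbA => /or3P[] /eqP->.
    - by apply/or3P/Or31/imsetP; exists (b, c); rewrite ?inE.
    - by apply/or3P/Or32/imsetP; exists (a, c); rewrite ?inE.
    - by apply/or3P/Or33/imsetP; exists (a, b); rewrite ?inE.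
  move/subset_leq_card/leq_trans; apply.
  apply: leq_trans (leq_card_setU _ _) _; rewrite !mulSn addn0 addnA leq_add //.
  by apply: leq_trans (leq_card_setU _ _) _; rewrite leq_add.
have := @sign_patterns_bound R N (3 * n ^ 2) _ f df J S f_poly df_poly f_affine dfJ Js.
have {}SP sg : sg \in S -> exists x, forall i, f i x != 0 /\ sg i = (0 < f i x).
  move=> /SP[p gp ->]; exists (\row_j p (enum_val j).1 0 (enum_val j).2) => t.
  rewrite /f ffunE; case: ifP => [/and3P[t1 t2 t3]|tN].
    by rewrite !mxE !enum_rankK; split=> //; exact: gp.
  rewrite oppr_eq0 oner_eq0 oppr_gt0 ltr10; split => //.
  suff -> : orient p t.1.1 t.1.2 t.2 = 0 by rewrite ltxx.
  move: tN; rewrite /dis /orient; do 3 (case: eqP => [->|_]; first by move=> _; ring).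
  by [].
move=> /(_ SP) bound.
have : (#|S| * N ^ N <= (4 * (N * (2 * (3 * n ^ 2)).+1).+1) ^ N)%N.
  apply: leq_trans (_ : 4 ^ N * (#|S| * N`!) <= _)%N.
    by rewrite mulnCA leq_mul2l expn_fact_bound orbT.
  by rewrite expnMn leq_mul2l bound orbT.
have [N0|N0] := posnP N; first by rewrite N0 expn0 muln1 -NE N0.
move=> le1; rewrite -NE -(leq_pmul2r (_ : 0 < N ^ N)%N) ?expn_gt0 ?N0 // -expnMn.
apply: leq_trans le1 _; apply: leq_expl.
rewrite !expnS expn0 muln1; have : (0 < n)%N by lia.
rewrite NE; nia.
Qed.
End OrderTypes.

(** * From drawings to order types in general position *)

Section Perturbation.
Import classical_sets topology normedtype derive realfun.
Import numFieldNormedType.Exports.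

Variables (R : realType) (V : finType).
Implicit Types p : V -> 'rV[R]_2.

(** The common point divides each edge in the ratio of the orientations of its ends with respect to
    the other edge; opposite signs put the parameters between 0 and 1. *)
Lemma crosses_common_point p e f : general_position p -> crosses (order_type p) e f ->
  exists l m : R, [/\ 0 <= l <= 1, 0 <= m <= 1 &
    forall k, (1 - l) * p e.1 0 k + l * p e.2 0 k = (1 - m) * p f.1 0 k + m * p f.2 0 k].
Proof.
case: e f => [a b] [c d] gp; rewrite /crosses !ffunE /= !inE !negb_or.
case/and3P => /and3P[/and3P[ab ac ad] /andP[bc bd] /andP[cd _]].
have opp (x y : R) : x != 0 -> y != 0 -> (0 < x) != (0 < y) ->
    x - y != 0 /\ 0 <= x / (x - y) <= 1.
  move=> x0 y0 xy; have : x * y < 0.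
    move: x0 y0 xy; case: (ltrgt0P x) => // x0 _; case: (ltrgt0P y) => // y0 _ _.
      by rewrite pmulr_rlt0.
    by rewrite nmulr_rlt0.
  move=> xy0; have : x - y != 0.
    by rewrite subr_eq0; apply: contraTneq xy0 => ->; rewrite -leNgt -expr2 sqr_ge0.
  move: x0; rewrite neq_lt => /orP[] x0 d0; split=> //.
    have ? : x - y < 0 by nra.
    by rewrite ler_ndivlMr // ler_ndivrMr // mul0r mul1r; apply/andP; split; nra.
  have ? : 0 < x - y by nra.
  by rewrite ler_pdivlMr // ler_pdivrMr // mul0r mul1r; apply/andP; split; nra.
move=> /(opp _ _ (gp _ _ _ ab ac bc) (gp _ _ _ ab ad bd)) [m0 m01].
have [ca da] : c != a /\ d != a by rewrite ![_ == a]eq_sym.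
have [cb db] : c != b /\ d != b by rewrite ![_ == b]eq_sym.
move=> /(opp _ _ (gp _ _ _ cd ca da) (gp _ _ _ cd cb db)) [l0 l01].
exists (orient p c d a / (orient p c d a - orient p c d b)).
exists (orient p a b c / (orient p a b c - orient p a b d)); split=> // k.
have lm : orient p a b c - orient p a b d = - (orient p c d a - orient p c d b).
  by rewrite /orient; ring.
rewrite lm; apply: (mulfI l0).
have simpl q u x y : q != 0 -> q * ((1 - u / q) * x + u / q * y) = (q - u) * x + u * y :> R.
  by move=> q0; field.
have simplN q u x y : q != 0 -> q * ((1 - u / - q) * x + u / - q * y) = (q + u) * x - u * y :> R.
  by move=> q0; field; rewrite q0.
rewrite simpl // simplN //; have [->|->] : k = 0 \/ k = 1.
  by case: k => -[|[|//]] ?; [left | right]; apply/val_inj.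
- by rewrite /orient; ring.
- by rewrite /orient; ring.
Qed.

(** The sum of the two coordinate distances attains a positive minimum on the compact square of
    parameters, and one coordinate carries at least half of it. *)
Lemma disjoint_segments_gap (a b c d : 'rV[R]_2) :
  (forall z, segment a b z -> ~ segment c d z) ->
  exists2 delta : R, 0 < delta & forall l m, 0 <= l <= 1 -> 0 <= m <= 1 ->
    exists k, delta <= `|(1 - l) * a 0 k + l * b 0 k - ((1 - m) * c 0 k + m * d 0 k)|.
Proof.
move=> disj.
pose g k (v : 'rV[R]_2) :=
  (1 - v 0 0) * a 0 k + v 0 0 * b 0 k - ((1 - v 0 1) * c 0 k + v 0 1 * d 0 k).
have g_cont k : continuous (g k).
  apply: (@polyfun_continuous _ _ 1).
  have -> : g k = fun v => (a 0 k - c 0 k) + ((b 0 k - a 0 k) * v 0 0 + (c 0 k - d 0 k) * v 0 1).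
    by apply/funext => v; rewrite /g; ring.
  apply: polyfunD; first exact: polyfun_le (polyfun_cst _ _).
  by apply: polyfunD; apply: polyfunZ; exact: polyfun_coord.
pose K := [set v : 'rV[R]_2 | forall j, (`[0, 1]%classic : set R) (v ord0 j)]%classic.
have cK : compact K.
  apply: (@rV_compact R _ (fun=> (`[0, 1]%classic : set R))) => j; exact: segment_compact.
pose f v : R := `|g 0 v| + `|g 1 v|.
have f_cont : continuous f.
  have nc k : continuous (fun v => `|g k v|).
    by move=> v; apply: (continuous_comp (@g_cont k v)); exact: norm_continuous.
  by move=> v; exact: (continuousD (nc 0 v) (nc 1 v)).
have [v vK vmin] : exists2 v, v \in K & forall w : 'rV[R]_2, w \in K -> f v <= f w.
  apply: EVT_min_rV cK _; last exact: continuous_subspaceT.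
  by exists 0 => j /=; rewrite mxE in_itv /= lexx ler01.
have vI j : 0 <= v 0 j <= 1 by move: vK; rewrite inE => /(_ j); rewrite /= in_itv.
exists (f v / 2).
  rewrite divr_gt0 // lt_neqAle addr_ge0 // andbT eq_sym; apply/negP.
  rewrite paddr_eq0 // !normr_eq0 => /andP[/eqP g0 /eqP g1].
  pose z := (1 - v 0 0) *: a + v 0 0 *: b.
  apply: (disj z); first by exists (v 0 0); have /andP[] := vI 0.
  exists (v 0 1); have /andP[v0 v1] := vI 1; split=> //.
  apply/rowP => k; have [->|->] : k = 0 \/ k = 1.
    by case: k => -[|[|//]] ?; [left | right]; apply/val_inj.
  - by apply/eqP; rewrite !mxE -subr_eq0 -g0 /g.
  - by apply/eqP; rewrite !mxE -subr_eq0 -g1 /g.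
move=> l m l01 m01.
pose w : 'rV[R]_2 := \row_j (if j == 0 then l else m).
have : f v <= f w.
  by apply: vmin; rewrite inE => j; rewrite /= in_itv /= mxE; case: ifP.
have gw k : g k w = (1 - l) * a 0 k + l * b 0 k - ((1 - m) * c 0 k + m * d 0 k).
  by rewrite /g !mxE.
rewrite {2}/f !gw => fw.
have [le0|lt0] := leP (f v / 2) `|(1 - l) * a 0 0 + l * b 0 0 - ((1 - m) * c 0 0 + m * d 0 0)|.
  by exists 0.
by exists 1; lra.
Qed.

Lemma general_position_perturbation p : exists p', [/\ general_position p',
  injective (fun v => p' v 0 0) &
  forall e f, (forall z, segment (p e.1) (p e.2) z -> ~ segment (p f.1) (p f.2) z) ->
    ~~ crosses (order_type p') e f].
Proof.
(* Moving the vertices along the moment curve adds to each orientation a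
   nonzero t^2 term (a Vandermonde determinant), which makes it nonzero for
   almost all t. *)
pose r (v : V) : R := (enum_rank v)%:R.
have r_inj : injective r by move=> u v /natr_inj/ord_inj/enum_rank_inj.
pose P (t : R) (v : V) : 'rV[R]_2 := \row_k (p v 0 k + t * r v ^+ k.+1).
have P0 t v : P t v 0 0 = p v 0 0 + t * r v by rewrite mxE.
have P1 t v : P t v 0 1 = p v 0 1 + t * r v ^+ 2 by rewrite mxE.
pose o (a b c : V) : {poly R} := (orient p a b c)%:P +
  ((p b 0 0 - p a 0 0) * (r c ^+ 2 - r a ^+ 2) + (r b - r a) * (p c 0 1 - p a 0 1) -
   (p c 0 0 - p a 0 0) * (r b ^+ 2 - r a ^+ 2) - (r c - r a) * (p b 0 1 - p a 0 1)) *: 'X +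
  ((r b - r a) * (r c - r a) * (r c - r b)) *: 'X^2.
have oE a b c t : (o a b c).[t] = orient (P t) a b c.
  by rewrite /o !hornerE /= /orient !P0 !P1; ring.
have o0 a b c : a != b -> a != c -> b != c -> o a b c != 0.
  move=> ab ac bc; apply/eqP => /(congr1 (fun q : {poly R} => q`_2)).
  rewrite !coefD !coefZ coefC coefX coefXn coef0 /= mulr0 !add0r mulr1 => /eqP.
  rewrite !mulf_eq0 !subr_eq0 !(inj_eq r_inj) ![_ == a]eq_sym (eq_sym c b).
  by rewrite (negPf ab) (negPf ac) (negPf bc).
pose x (u v : V) : {poly R} := (p v 0 0 - p u 0 0)%:P + (r v - r u) *: 'X.
have xE u v t : (x u v).[t] = P t v 0 0 - P t u 0 0.
  by rewrite /x !hornerE !P0; ring.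
have x0 u v : u != v -> x u v != 0.
  move=> uv; apply/eqP => /(congr1 (fun q : {poly R} => q`_1)).
  rewrite coefD coefZ coefC coefX coef0 /= add0r mulr1 => /eqP.
  by rewrite subr_eq0 (inj_eq r_inj) eq_sym (negPf uv).
(* One nonzero polynomial in [t] collects all degeneracies, collinear triples as well as equal
   abscissas. *)
pose Q := \prod_(t : V * V * V | [&& t.1.1 != t.1.2, t.1.1 != t.2 & t.1.2 != t.2])
            o t.1.1 t.1.2 t.2 *
          \prod_(u : V * V | u.1 != u.2) x u.1 u.2.
have Q0 : Q != 0.
  rewrite mulf_neq0 //; apply/prodf_neq0; first by move=> t /and3P[*]; exact: o0.
  by move=> u; exact: x0.
have /choice[gap gapP] (ef : (V * V) * (V * V)) : exists delta : R, 0 < delta /\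
    ((forall z, segment (p ef.1.1) (p ef.1.2) z -> ~ segment (p ef.2.1) (p ef.2.2) z) ->
     forall l m, 0 <= l <= 1 -> 0 <= m <= 1 -> exists k,
     delta <= `|(1 - l) * p ef.1.1 0 k + l * p ef.1.2 0 k -
               ((1 - m) * p ef.2.1 0 k + m * p ef.2.2 0 k)|).
  have [/disjoint_segments_gap[delta d0 dP]|nd] := pselect (forall z,
    segment (p ef.1.1) (p ef.1.2) z -> ~ segment (p ef.2.1) (p ef.2.2) z).
    by exists delta.
  (* Segments that meet impose no condition, so any positive value does. *)
  by exists 1; split.
pose n : R := 1 + #|V|%:R ^+ 2.
have n0 : 0 < n by rewrite ltr_pwDl // exprn_ge0.
have rn v k : 0 <= r v ^+ (k : 'I_2).+1 <= n.
  rewrite exprn_ge0 ?ler0n //= /n /r -!natrX -[1]/(1%:R) -natrD ler_nat.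
  have : (enum_rank v < #|V|)%N by exact: ltn_ord.
  move: (nat_of_ord (enum_rank v)) => i; move: #|V| => N iN.
  by case: k => -[|[|//]] ? /=; nia.
pose S := \sum_ef (gap ef)^-1.
have S0 : 0 <= S by apply: sumr_ge0 => ef _; rewrite invr_ge0 ltW // (gapP ef).1.
(* Every candidate [t = u a] is at most [1 / (n * (1 + S))]. Since [n] bounds the powers of [r] and
   [S] is at least each inverse gap, no gap can close. *)
pose u (a : nat) : R := (a.+1%:R * (n * (1 + S)))^-1.
have nS : 0 < n * (1 + S) by rewrite mulr_gt0 // ltr_pwDl.
have u_inj : injective u.
  by move=> a b /invr_inj/(mulIf (lt0r_neq0 nS))/natr_inj [].
have [a _ Qa] := poly_nonroot u_inj Q0 (leqnn _).
set t := u a in Qa; have t0 : 0 < t by rewrite invr_gt0 mulr_gt0.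
have tS : t * n * (1 + S) <= 1.
  by rewrite -mulrA /t /u invfM mulfVK ?lt0r_neq0 // invf_le1 ?ler1n ?ltr0n.
move: Qa; rewrite hornerM !horner_prod mulf_eq0 negb_or => /andP[/prodf_neq0 Qo /prodf_neq0 Qx].
have gpP : general_position (P t).
  by move=> a' b c ab ac bc; rewrite -oE; apply: (Qo (a', b, c)); rewrite ab ac bc.
exists (P t); split=> //.
  move=> v w E; apply/eqP; apply: contraT => vw; have := Qx (v, w) vw.
  by rewrite /= xE E subrr eqxx.
move=> e f disj; apply/negP => /(crosses_common_point gpP) [l [m [l01 m01 E]]].
have [d0 /(_ disj l m l01 m01) [k]] := gapP (e, f); apply/negP; rewrite -ltNge.
have gS : (gap (e, f))^-1 <= S.
  rewrite /S (bigD1 (e, f)) //= lerDl; apply: sumr_ge0 => ef _.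
  by rewrite invr_ge0 ltW // (gapP ef).1.
have tg : t * n < gap (e, f).
  rewrite -[gap _]invrK -[ltLHS]invrK ltf_pV2 ?posrE ?invr_gt0 ?mulr_gt0 //.
  apply: le_lt_trans gS _; apply: (@lt_le_trans _ _ (1 + S)); first by rewrite ltrDr.
  by rewrite -[leRHS]mul1r ler_pdivlMr ?mulr_gt0 // mulrC.
have := E k; rewrite !mxE => Ek; apply: le_lt_trans tg.
have -> : (1 - l) * p e.1 0 k + l * p e.2 0 k - ((1 - m) * p f.1 0 k + m * p f.2 0 k) =
  t * ((1 - m) * r f.1 ^+ k.+1 + m * r f.2 ^+ k.+1
    - ((1 - l) * r e.1 ^+ k.+1 + l * r e.2 ^+ k.+1)) by lra.
rewrite normrM gtr0_norm // ler_pM2l // ler_norml.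
move: (rn e.1 k) (rn e.2 k) (rn f.1 k) (rn f.2 k) l01 m01.
move: (_ ^+ _) (_ ^+ _) (_ ^+ _) (_ ^+ _) => x1 x2 x3 x4.
move=> /andP[? ?] /andP[? ?] /andP[? ?] /andP[? ?] /andP[? ?] /andP[? ?].
by apply/andP; split; nra.
Qed.

End Perturbation.

(** Edges of one plane subgraph with four distinct ends have disjoint segments and stay noncrossing
    under the perturbation; edges with a common end never satisfy [crosses]. Indices beyond the
    actual thickness get the empty class. *)
Lemma thickness_noncrossing_classes (R : realType) (G : sgraph) (k : nat) :
  (geometric_thickness R G <= k)%N ->
  exists p : G -> 'rV[R]_2, [/\ general_position p, injective (fun v => p v 0 0) &
    exists I : 'I_k -> {set G * G}, [/\ forall i e, e \in I i -> adj e.1 e.2,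
      forall i e f, e \in I i -> f \in I i -> ~~ crosses (order_type p) e f &
      forall e, adj e.1 e.2 -> exists i, e \in I i]].
Proof.
rewrite /geometric_thickness; case: ex_minnP => m /asboolP[p [_ pm]] _ mk.
have : plane_decomposition p m by rewrite -pm /drawing_thickness; case: ex_minnP => ? /asboolP.
case=> H [planeH _ edgesH].
have [p' [gp px_inj noncrossing]] := general_position_perturbation p.
exists p'; split=> //.
pose I (i : 'I_k) : {set G * G} := if insub (val i) is Some j
  then [set e | adj e.1 e.2 && ([set e.1; e.2] \in sub_edges (H j))] else set0.
exists I; split=> [i e|i e f|e eE].
- by rewrite /I; case: insub => [j|]; rewrite inE // => /andP[].
- rewrite /I; case: insub => [j|]; rewrite !inE // => /andP[_ eH] /andP[_ fH].
  have [uef|nuef] := boolP (uniq [:: e.1; e.2; f.1; f.2]); last first.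
    by rewrite /crosses (negPf nuef).
  have disj v : v \in [set e.1; e.2] -> v \notin [set f.1; f.2].
    move: uef; rewrite /= !inE !negb_or => /and3P[/and3P[_ ? ?] /andP[? ?] _].
    by case/orP => /eqP ->; apply/andP.
  apply: noncrossing => z ze zf; apply: (planeH j _ _ eH fH).
    by apply/eqP => E; have := disj e.1; rewrite -E !inE eqxx => /(_ isT).
  exists z; split; [by exists e.1, e.2 | by exists f.1, f.2 | case=> v].
  by rewrite inE => /andP[/disj /negPf ->].
have : [set e.1; e.2] \in edges G by apply/imsetP; exists e; rewrite ?inE.
rewrite -edgesH => /bigcupP[j _ eH].
exists (widen_ord mk j).
by rewrite /I /= valK inE eE.
Qed.

(** * A large family of regular graphs *)

(** Take the residues from 1 to [d./2] and their opposites. For odd [d] the modulus [r.+1] is even,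
    and its half, which is its own opposite, completes the set. *)
Lemma symmetric_connection_set (d r : nat) : (d < r.+1)%N -> ~~ odd (d * r.+1) ->
  exists S : {set 'I_r.+1}, [/\ #|S| = d, 0 \notin S & forall x, (- x \in S) = (x \in S)].
Proof.
move=> dr odr; pose h := d./2.
have dE : d = (odd d + h.*2)%N by rewrite odd_double_half.
pose f (i : 'I_h) : 'I_r.+1 := inord i.+1.
have fE i : f i = i.+1 :> nat by rewrite inordK //; have := ltn_ord i; lia.
have f_inj : injective f by move=> i j /(congr1 val); rewrite /= !fE => -[/ord_inj].
pose X := [set f i | i : 'I_h].
pose Y := [set - x | x in X].
have YE x : (x \in Y) = (- x \in X).
  apply/imsetP/idP => [[y yX ->]|xX]; first by rewrite opprK.
  by exists (- x); rewrite ?opprK.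
have cX : #|X| = h by rewrite card_imset // card_ord.
have cY : #|Y| = h by rewrite card_imset //; exact: oppr_inj.
have XY : [disjoint X & Y].
  rewrite -setI_eq0; apply/eqP/setP => x; rewrite in_setI YE in_set0; apply/andP.
  case=> /imsetP[i _ xi] /imsetP[j _ xj].
  have /(congr1 val) : f i + f j = 0 by rewrite -xi -xj subrr.
  rewrite /= !fE modn_small; first by lia.
  by have := ltn_ord i; have := ltn_ord j; lia.
have X0 : 0 \notin X by apply/imsetP => -[i _ /(congr1 val)]; rewrite /= fE.
have Y0 : 0 \notin Y by rewrite YE oppr0.
case od: (odd d); last first.
  exists (X :|: Y); split.
  - by rewrite cardsU (disjoint_setI0 XY) cards0 cX cY; lia.
  - by rewrite in_setU negb_or X0.
  - by move=> x; rewrite !in_setU !YE opprK orbC.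
have er : ~~ odd r.+1 by move: odr; rewrite oddM od.
pose m : 'I_r.+1 := inord (r.+1)./2.
have mE : m = (r.+1)./2 :> nat by rewrite inordK //; lia.
have r2 : ((r.+1)./2.*2 = r.+1)%N by rewrite -[RHS]odd_double_half (negPf er).
have mm : - m = m.
  by apply/val_inj; rewrite /= mE; rewrite modn_small; lia.
have mX : m \notin X.
  by apply/imsetP => -[i _ /(congr1 val)]; rewrite /= fE mE; have := ltn_ord i; lia.
exists (m |: (X :|: Y)); split.
- by rewrite cardsU1 in_setU YE mm (negPf mX) cardsU (disjoint_setI0 XY) cards0 cX cY; lia.
- rewrite !inE !negb_or X0 Y0 !andbT; apply/eqP => /(congr1 val) /=.
  by rewrite mE; lia.
- move=> x; rewrite !in_setU1 !in_setU !YE opprK [in LHS]orbC [in RHS]orbC; congr (_ || _).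
    by rewrite orbC.
  by rewrite -[in LHS]mm (inj_eq oppr_inj).
Qed.

(** A Cayley graph of the cyclic group of order [r]. *)
Lemma regular_relation_exists (d r : nat) : (d < r)%N -> ~~ odd (d * r) ->
  exists c : rel 'I_r, [/\ symmetric c, irreflexive c & forall a, #|[set b | c a b]| = d].
Proof.
case: r => // r dr odr; have [S [cS S0 SN]] := symmetric_connection_set dr odr.
exists (fun a b => b - a \in S); split=> [a b|a|a].
- by rewrite -SN opprB.
- by rewrite subrr (negPf S0).
rewrite -cS -[RHS](card_imset _ (@addIr _ a)); apply: eq_card => b.
rewrite inE; apply/idP/imsetP => [bS|[x xS ->]]; last by rewrite addrK.
by exists (b - a) => //; rewrite subrK.
Qed.

Section RegularFamily.
Variables (d g r : nat) (c : rel 'I_r).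
Hypotheses (c_sym : symmetric c) (c_irr : irreflexive c).
Hypothesis c_regular : forall a, #|[set b | c a b]| = d.

(* Vertex (i, x, b) is element x of the i-th group on side b; the r leftover
   vertices carry the fixed regular graph c. *)
Definition family_vertex : finType := ('I_d * 'I_g * bool + 'I_r)%type.

Implicit Type F : {ffun 'I_d * 'I_d -> 'S_g}.

Definition family_adj F : rel family_vertex := fun u v =>
  match u, v with
  | inl (i, x, false), inl (j, y, true) => F (i, j) x == y
  | inl (j, y, true), inl (i, x, false) => F (i, j) x == y
  | inr a, inr b => c a b
  | _, _ => false
  end.

Lemma family_adj_sym F : symmetric (family_adj F).
Proof. by move=> [[[i x] []]|a] [[[j y] []]|b] //=; exact: c_sym. Qed.

Lemma family_adj_irrefl F : irreflexive (family_adj F).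
Proof. by move=> [[[i x] []]|a] //=; exact: c_irr. Qed.

Definition family_graph F : sgraph := SGraph (family_adj_sym F) (family_adj_irrefl F).

Lemma card_family_vertex : #|family_vertex| = (2 * (d * g) + r)%N.
Proof. by rewrite card_sum !card_prod !card_ord card_bool; lia. Qed.

(** Each of the [d] groups on the opposite side contributes exactly one neighbour. *)
Lemma family_graph_regular F : regular (family_graph F) d.
Proof.
move=> [[[i x] []]|a].
- pose h (k : 'I_d) : family_vertex := inl (k, (F (k, i))^-1%g x, false).
  have h_inj : injective h by move=> k l [].
  rewrite -[RHS](card_ord d) -cardsT -[RHS](card_imset _ h_inj); apply: eq_card => v.
  rewrite inE; apply/idP/imsetP => [|[k _ ->]]; last by rewrite /= permKV.
  case: v => [[[j y] []]|b] //= /eqP yx; exists j => //.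
  by rewrite /h -yx permK.
- pose h (k : 'I_d) : family_vertex := inl (k, F (i, k) x, true).
  have h_inj : injective h by move=> k l [].
  rewrite -[RHS](card_ord d) -cardsT -[RHS](card_imset _ h_inj); apply: eq_card => v.
  rewrite inE; apply/idP/imsetP => [|[k _ ->]]; last by rewrite /=.
  by case: v => [[[j y] []]|b] //= /eqP <-; exists j.
- have h_inj : injective (fun b : 'I_r => inr b : family_vertex) by move=> b b' [].
  rewrite -[RHS](c_regular a) -[RHS](card_imset _ h_inj); apply: eq_card => v.
  rewrite inE; apply/idP/imsetP => [|[b + ->]]; last by rewrite inE.
  by case: v => [[[j y] []]|b] //= cab; exists b; rewrite ?inE.
Qed.

Definition bipartite_edge F (u : 'I_d * 'I_d * 'I_g) : family_vertex * family_vertex :=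
  (inl (u.1.1, u.2, false), inl (u.1.2, F u.1 u.2, true)).

(** Each edge is listed once, from side [false] to side [true]. The leftover edges are the same for
    all [F], so these edges alone distinguish the members of the family. *)
Definition bipartite_edges F : {set family_vertex * family_vertex} :=
  [set bipartite_edge F u | u : 'I_d * 'I_d * 'I_g].

Lemma card_bipartite_edges F : #|bipartite_edges F| = (d * d * g)%N.
Proof.
rewrite card_imset ?card_prod ?card_ord //.
by move=> [[i j] x] [[i' j'] x'] [-> -> ->].
Qed.

Lemma bipartite_edges_adj F e : e \in bipartite_edges F -> family_adj F e.1 e.2.
Proof. by case/imsetP => -[[i j] x] _ ->; rewrite /= eqxx. Qed.

Lemma bipartite_edges_inj : injective bipartite_edges.
Proof.
move=> F F' E; apply/ffunP => -[i j]; apply/permP => x.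
have : bipartite_edge F (i, j, x) \in bipartite_edges F' by rewrite -E imset_f.
by case/imsetP => -[[i' j'] x'] _ [<- <- <-].
Qed.

End RegularFamily.

(** * Counting the family *)

Lemma leq_card_bigcup (I T : finType) (A : {set I}) (B : I -> {set T}) b :
  (forall i, i \in A -> (#|B i| <= b)%N) -> (#|\bigcup_(i in A) B i| <= #|A| * b)%N.
Proof.
move=> Bb; rewrite -sum_nat_const.
elim/big_rec2: _ => [|i m U iA IH]; first by rewrite cards0.
by apply: leq_trans (leq_card_setU _ _) _; rewrite leq_add ?Bb.
Qed.

Section FamilyCounting.
Variables (R : realType) (d g r : nat) (c : rel 'I_r).
Hypotheses (c_sym : symmetric c) (c_irr : irreflexive c).
Variable k : nat.
Hypothesis thin : forall F : {ffun 'I_d * 'I_d -> 'S_g},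
  (geometric_thickness R (family_graph c_sym c_irr F) <= k)%N.
Variable l : nat.
Local Notation V := (family_vertex d g r).
Local Notation n := #|family_vertex d g r|.
Hypothesis card_n : (n <= 2 ^ l)%N.

Let ordk b : (#|[set: 'I_k]| * b = k * b)%N. Proof. by rewrite cardsT card_ord. Qed.

(** Edges of a single member are counted class by class. The resulting lower bound on [k] controls
    the roundings in [container_parameters]. *)
Lemma thickness_lower_bound : (d * d * g <= k * (4 * l * n))%N.
Proof.
pose F : {ffun 'I_d * 'I_d -> 'S_g} := [ffun => 1%g].
have [p [gp px_inj [I [Iadj Inc Icov]]]] := thickness_noncrossing_classes (thin F).
rewrite -(card_bipartite_edges r F) -ordk.
apply: (@leq_trans #|\bigcup_(i in [set: 'I_k]) I i|).
  apply/subset_leq_card/subsetP => e /bipartite_edges_adj eF.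
  by have [i eI] := Icov e (eF c); apply/bigcupP; exists i.
apply: leq_card_bigcup => i _; rewrite -cardsT.
apply: (plane_bound gp px_inj (l := l) (W := [set: V])); last by rewrite cardsT.
split=> // [e /Iadj|]; last exact: Inc.
by apply: contraTneq => ->; rewrite (@adj_irrefl (family_graph c_sym c_irr F)).
Qed.

(** The bipartite edges of a member are a subset of known size of a union of [k] containers. The
    three factors count order types, tuples of containers and subsets. *)
Lemma family_count_bound (Q q : nat) : (0 < l)%N -> (0 < Q)%N ->
  (64 * l ^ 2 * n <= q * Q)%N ->
  (g`! ^ (d * d) <=
   (32 * n ^ 2) ^ (2 * n) * (((n ^ 2).+1 ^ q) ^ k * 'C(k * (8 * l * n * Q + q), d * d * g)))%N.
Proof.
move=> l0 Q0 qQ.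
pose realizable (sg : {ffun V * V * V -> bool}) := exists p : V -> 'rV[R]_2,
  [/\ general_position p, injective (fun v => p v 0 0) & sg = order_type p].
pose Pat := [set sg | `[< realizable sg >]].
have cPat : (#|Pat| <= (32 * n ^ 2) ^ (2 * n))%N.
  apply: (@order_types_bound R) => sg; rewrite inE => /asboolP[p [gp _ ->]].
  by exists p.
(* Containers are chosen per order type rather than per point set, which leaves finitely many
   choices. *)
have /choice[Fam FamP] (sg : {ffun V * V * V -> bool}) : exists F : {set {set V * V}},
    sg \in Pat -> [/\ (#|F| <= (n ^ 2).+1 ^ q)%N,
    forall C, C \in F -> (#|C| <= 8 * l * n * Q + q)%N &
    forall I : {set V * V}, (forall e, e \in I -> e.1 != e.2) ->
      (forall e f, e \in I -> f \in I -> ~~ crosses sg e f) ->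
      exists2 C, C \in F & I \subset C].
  have [/[!inE] /asboolP[p [gp px_inj ->]]|nPat] := boolP (sg \in Pat); last by exists set0.
  by have [F FP] := plane_containers gp px_inj l0 card_n Q0 qQ; exists F.
pose m := (d * d * g)%N.
pose Draws (t : {ffun 'I_k -> {set V * V}}) :=
  [set E : {set V * V} | E \subset \bigcup_(i in [set: 'I_k]) t i & #|E| == m].
pose Tup sg : {set {ffun 'I_k -> {set V * V}}} := [set t in ffun_on (mem (Fam sg))].
have : ([set @bipartite_edges d g r F | F : {ffun 'I_d * 'I_d -> 'S_g}] \subset
    \bigcup_(sg in Pat) \bigcup_(t in Tup sg) Draws t).
  apply/subsetP => _ /imsetP[F _ ->].
  have [p [gp px_inj [I [Iadj Inc Icov]]]] := thickness_noncrossing_classes (thin F).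
  have sgP : order_type p \in Pat by rewrite inE; apply/asboolP; exists p.
  have [_ _ FamI] := FamP _ sgP.
  have /choice[t tP] i : exists C, C \in Fam (order_type p) /\ I i \subset C.
    have [|C CF IC] := FamI (I i) _ (Inc i); last by exists C.
    move=> e /Iadj; apply: contraTneq => ->.
    by rewrite (@adj_irrefl (family_graph c_sym c_irr F)).
  apply/bigcupP; exists (order_type p) => //.
  apply/bigcupP; exists (finfun t).
    by rewrite inE; apply/ffun_onP => i; rewrite ffunE; case: (tP i).
  rewrite inE card_bipartite_edges eqxx andbT.
  apply/subsetP => e /bipartite_edges_adj eF; have [i eI] := Icov e (eF c).
  by apply/bigcupP; exists i; rewrite ?ffunE //; apply: (subsetP (tP i).2).
move/subset_leq_card; rewrite card_imset; last exact: bipartite_edges_inj.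
rewrite card_ffun card_prod !card_ord card_Sn => /leq_trans; apply.
apply: leq_trans (leq_card_bigcup (b := ((n ^ 2).+1 ^ q) ^ k *
  'C(k * (8 * l * n * Q + q), m)) _) _; last by rewrite leq_mul2r cPat orbT.
move=> sg /FamP[cF FQ _].
apply: leq_trans (leq_card_bigcup (b := 'C(k * (8 * l * n * Q + q), m)) _) _.
  move=> t; rewrite inE => /ffun_onP tF; rewrite cards_draws; apply: leq_bin2l.
  rewrite -ordk; apply: leq_card_bigcup => i _.
  exact/FQ/tF.
rewrite leq_mul2r; apply/orP; right.
rewrite cardsE card_ffun_on card_ord; exact: leq_expl.
Qed.

End FamilyCounting.

(** * Asymptotic estimates *)

Lemma trunc_log_ln (R : realType) (n : nat) : (0 < n)%N -> 1 <= ln (n%:R : R) ->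
  ((trunc_log 2 n).+1)%:R <= 3 * ln (n%:R : R).
Proof.
move=> n0 L1; have n0R : 0 < n%:R :> R by rewrite ltr0n.
(* This bounds the binary logarithm by twice the natural one, and the successor costs at most one
   more [ln n]. *)
have ln2 : 1 / 2 <= ln (2 : R).
  rewrite -(expRK (1 / 2)) ler_ln ?posrE ?expR_gt0 //.
  have := expR_ge1Dx (- (1 / 2) : R); rewrite expRN => h.
  rewrite -[expR _]invrK -[leRHS]invrK lef_pV2 ?posrE ?invr_gt0 ?expR_gt0 //; lra.
have : ln ((2 ^ trunc_log 2 n)%:R : R) <= ln (n%:R : R).
  by rewrite ler_ln ?posrE ?ltr0n ?expn_gt0 // ler_nat trunc_logP.
have -> : (2 ^ trunc_log 2 n)%:R = 2 ^+ trunc_log 2 n :> R by rewrite natrX.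
rewrite lnXn // -[ln 2 *+ _]mulr_natr.
have -> : (trunc_log 2 n).+1%:R = (trunc_log 2 n)%:R + 1 :> R by rewrite natr1.
move: (ln 2) ln2 (trunc_log 2 n)%:R (ler0n R (trunc_log 2 n)) => a a2 x x0; nra.
Qed.

(** The term of degree four of the exponential series suffices. *)
Lemma polylog_le_expR (R : realType) (K eps L : R) : 0 < eps -> 0 <= K ->
  24 * K / eps ^+ 4 <= L -> 0 <= L -> K * L ^+ 3 <= expR (eps * L).
Proof.
move=> e0 K0 KL L0.
have := expR_ge1Dxn 3 (mulr_ge0 (ltW e0) L0); apply: le_trans.
have -> : (3.+1)`!%:R = 24 :> R by [].
apply: ler_wpDl => //; rewrite exprMn ler_pdivlMr //.
move: KL; rewrite ler_pdivrMr ?exprn_gt0 // => KL.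
have : 0 <= L ^+ 3 by rewrite exprn_ge0.
rewrite [L ^+ 4]exprS; move: (L ^+ 3) (eps ^+ 4) KL => x y; nra.
Qed.

(** Factorials become powers: [expn_fact_bound], used for [g] and for [d * d * g], loses a factor 4
    per edge each time, whence 16. *)
Lemma count_simplified (d g n q k W : nat) :
  (g`! ^ (d * d) <= (32 * n ^ 2) ^ (2 * n) * (((n ^ 2).+1 ^ q) ^ k * 'C(W, d * d * g)))%N ->
  ((g * (d * d * g)) ^ (d * d * g) <=
    (16 * W) ^ (d * d * g) * ((32 * n ^ 2) ^ (2 * n) * (n ^ 2).+1 ^ (q * k)))%N.
Proof.
set m := (d * d * g)%N; set X := ((32 * n ^ 2) ^ (2 * n))%N => le1.
have gm : (g ^ m <= 4 ^ m * g`! ^ (d * d))%N.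
  have mE a : (a ^ m = (a ^ g) ^ (d * d))%N by rewrite -expnM mulnC.
  by rewrite !mE -expnMn leq_expl // expn_fact_bound.
have ffactX a b : (a ^_ b <= a ^ b)%N.
  rewrite ffact_prod -[X in (_ <= _ ^ X)%N](card_ord b) -prod_nat_const.
  by apply: leq_prod => i _; exact: leq_subr.
rewrite expnMn; apply: leq_trans (leq_mul gm (expn_fact_bound m)) _.
have -> : (4 ^ m * g`! ^ (d * d) * (4 ^ m * m`!) = 16 ^ m * (g`! ^ (d * d) * m`!))%N.
  by rewrite mulnACA -expnMn.
rewrite expnMn -!mulnA leq_mul2l; apply/orP; right.
apply: leq_trans (leq_mul le1 (leqnn m`!)) _.
rewrite -!mulnA bin_ffact -expnM; apply: leq_trans (_ : X * ((n ^ 2).+1 ^ (q * k) * W ^ m) <= _)%N.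
  by rewrite !leq_mul2l ffactX !orbT.
by rewrite mulnA mulnC.
Qed.

(** [q] is about [n * d / (96 * E * k)], so that [k] containers are determined by a small fraction
    of [n * d] edges. [Q] is then about the least value that [plane_containers] allows. *)
Lemma container_parameters (E d g n k l : nat) :
  (0 < E)%N -> (0 < d)%N -> (0 < k)%N -> (0 < l)%N -> (0 < n)%N ->
  (3 * n <= 8 * (d * g))%N -> (d * d * g <= k * (4 * l * n))%N ->
  exists Q q, [/\ (0 < Q)%N, (64 * l ^ 2 * n <= q * Q)%N,
    (q * k * (96 * E) <= n * d + 96 * E * k)%N, (0 < q)%N &
    (k * (8 * l * n * Q + q) * d <= 20 * 75 * 96 * E * l ^ 3 * n * k ^ 2)%N].
Proof.
move=> E0 d0 k0 l0 n0 dg thick.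
(* This absorbs the roundings of [Q] and [q]: below, 75 = 64 + 11 and 12 = 11 + 1, and finally 20 =
   8 + 12. *)
have dkl : (d <= 11 * k * l)%N.
  have : (3 * d * n <= 32 * k * l * n)%N.
    have -> : (3 * d * n = d * (3 * n))%N by ring.
    have -> : (32 * k * l * n = 8 * (k * (4 * l * n)))%N by ring.
    apply: leq_trans (leq_mul (leqnn d) dg) _.
    by rewrite mulnCA leq_mul2l mulnA.
  by rewrite leq_pmul2r // -!mulnA; move: (k * l)%N => x; clear; lia.
pose Q := ((64 * l ^ 2 * (96 * E) * k) %/ d).+1.
pose q := ((n * d) %/ (96 * E * k)).+1.
have b0 : (0 < 96 * E * k)%N by rewrite !muln_gt0 E0 k0.
have Qd : (Q * d <= 75 * 96 * l ^ 2 * E * k)%N.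
  have : (Q * d <= 64 * l ^ 2 * (96 * E) * k + d)%N.
    by rewrite /Q -[X in (X * d <= _)%N]addn1 mulnDl mul1n leq_add2r leq_trunc_div.
  move/leq_trans; apply; rewrite -mulnn.
  have : (k * l <= l * l * E * k)%N.
    by rewrite mulnC -!mulnA leq_mul2l mulnA leq_pmull ?orbT // muln_gt0 l0.
  move: dkl; clear; have -> : (64 * (l * l) * (96 * E) * k = 64 * 96 * (l * l * E * k))%N by ring.
  have -> : (75 * 96 * (l * l) * E * k = 75 * 96 * (l * l * E * k))%N by ring.
  by rewrite -mulnA; move: (l * l * E * k)%N (k * l)%N => x y; lia.
have qk1 : (q.-1 * (96 * E * k) <= n * d)%N by rewrite leq_trunc_div.
have ql : (q <= 12 * l * n)%N.
  have : (q.-1 * k <= 11 * l * n * k)%N.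
    apply: leq_trans (_ : q.-1 * (96 * E * k) <= _)%N.
      by rewrite leq_mul2l mulnC leq_pmulr ?orbT // muln_gt0.
    apply: leq_trans qk1 _; apply: leq_trans (leq_mul (leqnn n) dkl) _.
    by rewrite leq_eqVlt; apply/orP; left; apply/eqP; ring.
  rewrite leq_pmul2r // => q11; have -> : q = q.-1.+1 by [].
  apply: leq_ltn_trans q11 _.
  have : (0 < l * n)%N by rewrite muln_gt0 l0.
  by rewrite -!mulnA; move: (l * n)%N => x; lia.
exists Q, q; split=> //.
- have h1 : (n * d < q * (96 * E * k))%N by rewrite -ltn_divLR.
  have h2 : (64 * l ^ 2 * (96 * E) * k < Q * d)%N by rewrite -ltn_divLR.
  have db0 : (0 < d * (96 * E * k))%N by rewrite muln_gt0 d0.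
  rewrite -(leq_pmul2r db0).
  have := leq_mul (ltnW h1) (ltnW h2).
  by congr (_ <= _)%N; ring.
- move: qk1; have -> : (q = q.-1 + 1)%N by rewrite addn1.
  have -> : ((q.-1 + 1) * k * (96 * E) = q.-1 * (96 * E * k) + 96 * E * k)%N by ring.
  by rewrite leq_add2r addn1.
have WQ : (k * (8 * l * n * Q + q) <= 20 * k * l * n * Q)%N.
  have : (q <= 12 * l * n * Q)%N by rewrite (leq_trans ql) // leq_pmulr.
  have -> : (20 * k * l * n * Q = k * (20 * l * n * Q))%N by ring.
  move=> qQ; rewrite leq_mul2l; apply/orP; right.
  apply: leq_trans (leq_add (leqnn _) qQ) _.
  by rewrite -!mulnA; move: (l * (n * Q))%N => x; clear; lia.
apply: leq_trans (_ : 20 * k * l * n * (Q * d) <= _)%N.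
  by rewrite mulnA leq_mul2r WQ orbT.
apply: leq_trans (leq_mul (leqnn _) Qd) _.
by rewrite leq_eqVlt; apply/orP; left; apply/eqP; ring.
Qed.

(** After division by [L], the [4 * N] from the order types is balanced, up to [12 * D], by the
    [8 * x] from the exponent [4 / D]. The remaining [eps * D * x] exceeds all error terms. *)
Lemma exponent_contradiction (R : realFieldType) (eps L D N x lW l32 lN qk : R) :
  0 < eps -> 0 < L -> 1 <= D -> 0 < N -> 1024 <= eps * L -> 1024 <= eps * N ->
  N <= 2 * x + 3 * D -> 3 * N <= 8 * x ->
  lW <= 2 * L - 8 / D * L - eps * L -> l32 <= 31 -> lN <= 3 * L ->
  0 <= qk -> qk <= eps * N * D / 48 ->
  D * x * (2 * L) <= D * x * lW + (2 * N * (l32 + 2 * L) + qk * lN) -> False.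
Proof.
move=> e0 LR D1 nR epsL epsn x1 x2 lnWm ln32 lnn2 qk0 qkN main.
have dR : 0 < D by apply: lt_le_trans D1.
have key : (8 * x + eps * D * x) * L <= 2 * N * 31 + 4 * N * L + eps * N * D / 16 * L.
  have m0 : 0 <= D * x by rewrite mulr_ge0 ?(ltW dR) //; lra.
  have := ler_wpM2l m0 lnWm.
  have -> : D * x * (2 * L - 8 / D * L - eps * L) =
      D * x * (2 * L) - (8 * x + eps * D * x) * L by field; rewrite gt_eqF.
  have := ler_wpM2l qk0 lnn2.
  have : qk * (3 * L) <= eps * N * D / 48 * (3 * L) by rewrite ler_wpM2r ?mulr_ge0 // ltW.
  have : 2 * N * (l32 + 2 * L) <= 2 * N * (31 + 2 * L).
    by rewrite ler_wpM2l ?mulr_ge0 ?(ltW nR) // lerD2r.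
  by move: main; lra.
have {}key : 8 * x + eps * D * x <= eps * N / 16 + 4 * N + eps * N * D / 16.
  rewrite -(ler_pM2r LR); apply: le_trans key _.
  have : N * 1024 <= N * (eps * L) by rewrite ler_pM2l.
  by lra.
have eDx : eps * D * (3 * N) <= eps * D * (8 * x) by rewrite ler_pM2l ?mulr_gt0.
have eND : eps * N <= eps * N * D by rewrite ler_peMr ?mulr_ge0 // ltW.
have D1024 : D * 1024 <= D * (eps * N) by rewrite ler_pM2l.
by lra.
Qed.

(** Taking logarithms of the count reduces everything to [exponent_contradiction], with [x] the real
    number [d * g] and [lW] the logarithm of [128 * W]. *)
Lemma counting_contradiction (R : realType) (eps : R) (E d n g k : nat) :
  let L : R := ln n%:R in let l := (trunc_log 2 n).+1 in
  0 < eps -> eps^-1 <= E%:R ->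
  (0 < d)%N -> (0 < k)%N -> (12 * d <= n)%N -> (n <= 2 * (d * g) + 3 * d)%N ->
  1 <= L -> 1024 / eps <= L -> (1152 / eps) ^+ 2 <= L ->
  24 * (27 * (128 * (20 * 75 * 96 * E%:R) * 12 ^+ 2)) / eps ^+ 4 <= L ->
  ln (k%:R : R) <= ln (12 : R) + ln (d%:R : R) / 2 + (1 / 2 - 4 / d%:R - eps) * L ->
  (d * d * g <= k * (4 * l * n))%N ->
  (forall Q q, (0 < Q)%N -> (64 * l ^ 2 * n <= q * Q)%N ->
    (g`! ^ (d * d) <= (32 * n ^ 2) ^ (2 * n) *
      (((n ^ 2).+1 ^ q) ^ k * 'C(k * (8 * l * n * Q + q), d * d * g)))%N) ->
  False.
Proof.
move=> L l e0 eE d0 k0 dn ng L1 L2 L3 L4 kL thick count.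
have E0 : (0 < E)%N by rewrite -(ltr0n R); apply: lt_le_trans eE; rewrite invr_gt0.
have n12 : (12 <= n)%N by move: dn d0; clear; lia.
have n0 : (0 < n)%N by apply: leq_trans n12.
have dg : (3 * n <= 8 * (d * g))%N by move: dn ng; clear; lia.
have l0 : (0 < l)%N by [].
have [Q [q [Q0 Qq qk q0 Wd]]] := container_parameters E0 d0 k0 l0 n0 dg thick.
set W := (k * (8 * l * n * Q + q))%N in Wd.
have W0 : (0 < W)%N by rewrite /W muln_gt0 k0 addn_gt0 q0 orbT.
set m := (d * d * g)%N.
have main := count_simplified (count Q q Q0 Qq); rewrite -/m -/W in main.
clear count.
(* This replaces [g * m] by [n ^ 2]; its factor 8 turns 16 into 128. *)
have gm : (n ^ 2 <= 8 * (g * m))%N.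
  have := leq_mul dg dg; have -> : (8 * (d * g) * (8 * (d * g)) = 64 * (g * m))%N by rewrite /m; ring.
  have -> : (3 * n * (3 * n) = 9 * n ^ 2)%N by ring.
  by move: (n ^ 2)%N (g * m)%N; clear => x y; lia.
have {}main : ((n ^ 2) ^ m <= (128 * W) ^ m * ((32 * n ^ 2) ^ (2 * n) * (n ^ 2).+1 ^ (q * k)))%N.
  apply: leq_trans (leq_expl m gm) _; rewrite expnMn.
  apply: leq_trans (leq_mul (leqnn _) main) _.
  have -> : (128 * W = 8 * (16 * W))%N by rewrite mulnA.
  by rewrite (expnMn 8) -!mulnA.
have nR : 0 < n%:R :> R by rewrite ltr0n.
have dR : 0 < d%:R :> R by rewrite ltr0n.
have kR : 0 < k%:R :> R by rewrite ltr0n.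
have lR : 0 < l%:R :> R by rewrite ltr0n.
have ER : 0 < E%:R :> R by rewrite ltr0n.
have WR : 0 < W%:R :> R by rewrite ltr0n.
have LR : 0 < L by apply: lt_le_trans L1.
have lnX (x : R) e : 0 < x -> ln (x ^+ e) = e%:R * ln x by move=> x0; rewrite lnXn // mulr_natl.
have main_ln : m%:R * (2 * L) <= m%:R * (ln 128 + ln W%:R) +
    ((2 * n)%:R * (ln 32 + 2 * L) + (q * k)%:R * ln (n ^ 2).+1%:R).
  have mainR : (n%:R ^+ 2) ^+ m <= (128 * W%:R) ^+ m *
      ((32 * n%:R ^+ 2) ^+ (2 * n) * (n ^ 2).+1%:R ^+ (q * k)) :> R.
    by rewrite -!(natrX, natrM) ler_nat.
  move: mainR; rewrite -ler_ln ?posrE; last 2 first.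
  - by rewrite !exprn_gt0.
  - by rewrite !mulr_gt0 // !exprn_gt0 ?mulr_gt0 ?exprn_gt0.
  rewrite lnM ?posrE; last 2 first.
  - by rewrite exprn_gt0 ?mulr_gt0.
  - by rewrite mulr_gt0 // !exprn_gt0 ?mulr_gt0 ?exprn_gt0.
  rewrite lnM ?posrE; last 2 first.
  - by rewrite !exprn_gt0 ?mulr_gt0 ?exprn_gt0.
  - by rewrite exprn_gt0.
  rewrite !lnX ?mulr_gt0 ?exprn_gt0 //.
  by rewrite (lnM (x := 128)) ?posrE // (lnM (x := 32)) ?posrE ?exprn_gt0 // lnX //.
have lnW : ln W%:R + ln d%:R <= ln (20 * 75 * 96 * E%:R) + 3 * ln l%:R + L + 2 * ln k%:R :> R.
  have cR : 0 < 20 * 75 * 96 * E%:R :> R by rewrite !mulr_gt0.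
  rewrite -lnM ?posrE // -[3 * _]lnX // -[2 * ln k%:R]lnX // -!lnM ?posrE;
    rewrite ?mulr_gt0 ?exprn_gt0 //.
  rewrite ler_ln ?posrE ?mulr_gt0 ?exprn_gt0 //.
  by rewrite -!natrX -!natrM ler_nat.
have lnl : ln l%:R <= ln 3 + ln L.
  rewrite -lnM ?posrE // ler_ln ?posrE ?mulr_gt0 //; exact: trunc_log_ln.
(* The bound on [2 * ln k] contains [- 2 * eps * L]. One [eps * L] absorbs the constants and the
   powers of [l] here, the other survives in [lnWm]. *)
have small : ln (128 : R) + ln (20 * 75 * 96 * E%:R) + 2 * ln 12 + 3 * (ln 3 + ln L) <= eps * L.
  have c0 : 0 < 20 * 75 * 96 * E%:R :> R by rewrite !mulr_gt0.
  have c1 : 0 < 27 * (128 * (20 * 75 * 96 * E%:R) * 12 ^+ 2) :> R.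
    by rewrite !mulr_gt0 // exprn_gt0.
  have := polylog_le_expR e0 (ltW c1) L4 (ltW LR).
  have L3_gt0 : 0 < L ^+ 3 by rewrite exprn_gt0.
  rewrite -[X in X <= _ -> _]lnK ?posrE ?mulr_gt0 // ler_expR; apply: le_trans.
  have c2 : 0 < 12 ^+ 2 :> R by rewrite exprn_gt0.
  have c3 : 0 < 128 * (20 * 75 * 96 * E%:R) :> R by rewrite mulr_gt0.
  rewrite (lnM (x := 27 * _)) ?posrE // (lnM (x := 27)) ?posrE ?mulr_gt0 //.
  rewrite (lnM (x := 128 * _)) ?posrE // (lnM (x := 128)) ?posrE //.
  have -> : 27 = 3 ^+ 3 :> R by rewrite -natrX.
  rewrite !lnX //; clear; move: (ln _) (ln _) (ln _) (ln _) (ln _) => *; lra.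
have ln32 : ln (32 : R) <= 31.
  by have := @le_ln1Dx R 31; have -> : 1 + 31 = 32 :> R by []; apply; clear; lra.
have nL : L <= n%:R.
  rewrite -[leRHS]expRK ler_ln ?posrE ?expR_gt0 //.
  by apply: le_trans (expR_ge1Dx _); rewrite lerDr.
have lnn2 : ln (n ^ 2).+1%:R <= 3 * L :> R.
  rewrite /L -lnX // ler_ln ?posrE ?exprn_gt0 ?ltr0n // -natrX ler_nat.
  by rewrite !expnS expn0; move: n12; clear; nia.
have epsL : 1024 <= eps * L by move: L2; rewrite ler_pdivrMr // mulrC.
have epsn : 1024 <= eps * n%:R by apply: le_trans epsL _; rewrite ler_pM2l.
set D : R := d%:R in dR kL lnW *; set N : R := n%:R in nR nL epsn *.
have D1 : 1 <= D by rewrite ler1n.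
(* As [k ^ 2] is at most [144 * D * N], the rounding term in the bound on [q * k] is harmless for
   large [N]. *)
have kN : k%:R <= eps * N * D / 96.
  have k2 : k%:R ^+ 2 <= 144 * D * N.
    rewrite -ler_ln ?posrE ?exprn_gt0 ?mulr_gt0 // lnX // !lnM ?posrE ?mulr_gt0 //.
    have -> : 144 = 12 ^+ 2 :> R by rewrite -natrX.
    rewrite lnX // -/L; have : 0 <= (4 / D + eps) * L by rewrite mulr_ge0 ?addr_ge0 ?divr_ge0 // ltW.
    by move: kL; move: (4 / D) => z; clear; lra.
  rewrite -ler_sqr ?nnegrE ?ler0n ?divr_ge0 ?mulr_ge0 ?(ltW e0) ?(ltW nR) ?(ltW dR) //.
  apply: le_trans k2 _.
  have N2 : 1152 ^+ 2 <= eps ^+ 2 * N.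
    move: L3; rewrite expr_div_n ler_pdivrMr ?exprn_gt0 // => /le_trans; apply.
    by rewrite mulrC ler_pM2l ?exprn_gt0.
  have : 1152 ^+ 2 * (N * D * D) <= (eps ^+ 2 * N) * (N * D * D).
    by rewrite ler_pM2r ?mulr_gt0.
  have : N * D <= N * D * D by rewrite ler_peMr ?mulr_ge0 // ltW.
  have -> : (eps * N * D / 96) ^+ 2 = eps ^+ 2 * N * (N * D * D) / 96 ^+ 2 by field.
  have -> : 144 * D * N = 144 * (N * D) by ring.
  move: (N * D) (N * D * D) (eps ^+ 2 * N * (N * D * D)) => z y x.
  by rewrite ler_pdivlMr ?exprn_gt0 // !expr2; clear; lra.
have qkN : (q * k)%:R <= eps * N * D / 48 :> R.
  have : (q * k)%:R * (96 * E%:R) <= N * D + 96 * E%:R * k%:R :> R by rewrite -!natrM -natrD ler_nat.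
  have : 1 <= eps * E%:R by move: eE; rewrite -ler_pdivrMl // mulr1.
  set w := eps * E%:R => w1 qk2.
  have w0 : 0 < w by apply: lt_le_trans w1.
  have : w * (96 * (q * k)%:R) <= w * (eps * N * D + 96 * k%:R).
    have := ler_wpM2l (ltW e0) qk2.
    have : eps * N * D <= w * (eps * N * D) by rewrite ler_peMl ?mulr_ge0 // ltW.
    by rewrite /w; clear; lra.
  by rewrite ler_pM2l //; move: kN; clear; lra.
pose x : R := (d * g)%:R.
have mE : m%:R = D * x by rewrite /x -natrM mulnA.
have x1 : N <= 2 * x + 3 * D by rewrite /x -!natrM -natrD ler_nat.
have x2 : 3 * N <= 8 * x by rewrite /x -!natrM ler_nat.
have lnWm : ln 128 + ln W%:R <= 2 * L - 8 / D * L - eps * L.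
  move: kL lnW lnl small; rewrite -/L; have -> : 8 / D = 2 * (4 / D) by rewrite mulrA -natrM.
  by move: (4 / D) => z; clear; lra.
have qk0 : 0 <= (q * k)%:R :> R by [].
apply: (exponent_contradiction e0 LR D1 nR epsL epsn x1 x2 lnWm ln32 lnn2 qk0 qkN).
by move: main_ln; rewrite mE natrM.
Qed.

(** Degrees sum to an even number, so a [Delta]-regular graph on [n] vertices requires [Delta * n]
    to be even; hence the parity hypothesis. *)
Theorem theorem1 (R : realType) :
  exists c : R, 0 < c /\
  forall eps : R, 0 < eps ->
  exists n0 : nat,
  forall Delta n : nat,
    (9 <= Delta)%N -> (n0 < n)%N -> c * Delta%:R <= n%:R ->
    ~~ odd (Delta * n) ->
    exists G : sgraph,
      [/\ #|G| = n, regular G Delta &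
          c * Num.sqrt Delta%:R * n%:R `^ (1 / 2 - 4 / Delta%:R - eps)
            <= (geometric_thickness R G)%:R].
Proof.
(* From [12 * Delta <= n] and at most [3 * Delta] leftover vertices follows [3 * n <= 8 * (d * g)].
   As a factor of the lower bound, 12 is absorbed by [eps] for large [n]. *)
exists 12; split=> // eps e0.
pose E := (Num.truncn eps^-1).+1.
have eE : eps^-1 <= E%:R by rewrite ltW // truncnS_gt.
(* The thresholds serve the final linear comparison, the bound on [k] (1152 = 96 * 12) and, for
   [L3], [polylog_le_expR]. *)
pose L1 := 1024 / eps; pose L2 := (1152 / eps) ^+ 2.
pose L3 := 24 * (27 * (128 * (20 * 75 * 96 * E%:R) * 12 ^+ 2)) / eps ^+ 4.
have L10 : 0 <= L1 by rewrite divr_ge0 // ltW.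
have L20 : 0 <= L2 by rewrite sqr_ge0.
have L30 : 0 <= L3.
  by rewrite divr_ge0 ?exprn_ge0 ?(ltW e0) // !mulr_ge0 ?exprn_ge0 ?ler0n.
exists (Num.truncn (expR (1 + L1 + L2 + L3))) => d n d9 n0n dn odn.
have d0 : (0 < d)%N by apply: leq_trans d9.
have {}dn : (12 * d <= n)%N by rewrite -(ler_nat R) natrM.
have n0 : (0 < n)%N by apply: leq_trans dn; rewrite muln_gt0.
have LL : 1 + L1 + L2 + L3 <= ln (n%:R : R).
  rewrite -[leLHS]expRK ler_ln ?posrE ?expR_gt0 ?ltr0n //.
  by move: n0n; rewrite truncn_lt_nat ?expR_ge0 // => /ltW.
have [ln1 lnL1 lnL2 lnL3] : [/\ 1 <= ln (n%:R : R), L1 <= ln n%:R, L2 <= ln n%:R & L3 <= ln n%:R].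
  clear n0n; move: LL L10 L20 L30; move: L1 L2 L3 => a b c *; split; lra.
(* Subtracting [d + 1] first gives [d < r <= 3 * d]: enough leftover vertices for a [d]-regular
   graph, and few enough to keep [2 * (d * g)] close to [n]. *)
pose g := ((n - d - 1) %/ (2 * d))%N; pose r := (n - 2 * (d * g))%N.
have d20 : (0 < 2 * d)%N by rewrite muln_gt0.
have g1 : (g * (2 * d) <= n - d - 1)%N by exact: leq_trunc_div.
have g2 : (n - d - 1 < g.+1 * (2 * d))%N by exact: ltn_ceil.
have g0 : (0 < g)%N by rewrite divn_gt0 //; move: d0 dn; clear; lia.
have dg2 : (g * (2 * d) = 2 * (d * g))%N by rewrite mulnC mulnA.
rewrite dg2 in g1; rewrite mulSn dg2 in g2.
have dr : (d < r)%N by rewrite /r; move: (d * g)%N d0 dn g1; clear; lia.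
have nE : (2 * (d * g) + r = n)%N by rewrite /r; move: (d * g)%N g1; clear; lia.
(* [n] and [r] differ by an even number, so the parity condition passes to the leftover graph. *)
have odr : ~~ odd (d * r).
  by move: odn; rewrite -nE mulnDr oddD !oddM /= andbF.
have [c [c_sym c_irr c_reg]] := regular_relation_exists dr odr.
have cardG : #|family_vertex d g r| = n by rewrite card_family_vertex.
apply: contrapT => noG.
set B := 12 * _ * _ in noG.
have B0 : 0 <= B by rewrite !mulr_ge0 ?sqrtr_ge0 ?powR_ge0.
have thin (F : {ffun 'I_d * 'I_d -> 'S_g}) :
    (geometric_thickness R (family_graph c_sym c_irr F) <= Num.truncn B)%N.
  rewrite truncn_ge_nat // leNgt; apply/negP => /ltW lB; apply: noG.
  exists (family_graph c_sym c_irr F); split; [exact: cardG | | exact: lB].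
    exact: (@family_graph_regular d g r c c_sym c_irr c_reg F).
set k := Num.truncn B in thin.
set l := (trunc_log 2 n).+1.
have nl : (#|family_vertex d g r| <= 2 ^ l)%N by rewrite cardG ltnW // trunc_log_ltn.
have thick := thickness_lower_bound thin nl.
have count := family_count_bound thin nl.
rewrite cardG in thick count.
have k0 : (0 < k)%N.
  by rewrite lt0n; apply: contraTneq thick => ->; rewrite mul0n -ltnNge !muln_gt0 d0 g0.
apply: (@counting_contradiction R eps E d n g k) => //.
- by move: (d * g)%N g2; clear; lia.
- have kB : k%:R <= B by rewrite -truncn_ge_nat.
  apply: (@le_trans _ _ (ln B)).
    rewrite ler_ln ?posrE ?ltr0n //.
    by apply: lt_le_trans kB; rewrite ltr0n.
  have dR : 0 < d%:R :> R by rewrite ltr0n.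
  rewrite /B !lnM ?posrE ?mulr_gt0 ?sqrtr_gt0 ?powR_gt0 ?ltr0n //.
  by rewrite ln_powR -powR12_sqrt ?ler0n // ln_powR [2^-1 * _]mulrC.
- by move=> Q q; exact: count.
Qed.
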